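(* Let $n\ge 2$ and $l=\lfloor n/2\rfloor$. Let $\mu$ be a nondegenerate probability measure on the braid group $B(n+1)$; if $n+1=3$, assume moreover that $\mu(\sigma_i)\neq 0$ and $\mu(\sigma_i^{-1})\neq 0$ for $i=1,2$. Let $\rho_n:B(n+1)\to Sp(2l,\mathbb{Z})$ be the symplectic representation. Let $P$ be a polynomial in $(2l)^2$ variables with coefficients in $\mathbb{Z}$ and, for $M=(m_{ij})\in Sp(2l,\mathbb{Z})$, write $P(M)$ for the value of $P$ at the entries $(m_{ij})_{1\le i,j\le 2l}$ of $M$. Suppose that $P$ does not vanish identically on $Sp(2l,\mathbb{Z})$. Then the set $$\{\beta\in B(n+1): P(\rho_n(\beta))=0\}$$ is transient for the right random $\mu$-walk.
   Context: $B(n+1)$ is the group of braids with $n+1$ strands, with standard generators $\sigma_1,\dots,\sigma_n$. Symplectic representation. Let $H=\mathbb{Z}^n$ with basis $e_1,\dots,e_n$ and alternating form $I$ given by $I(e_i,e_{i+1})=1$ and $I(e_i,e_j)=0$ if $|i-j|\ge 2$ (this is $H_1(X,\mathbb{Z})$ with its intersection form, for a surface $X$ whose first homology is generated by a chain of $n$ loops). The generator $\sigma_i$ acts on $H$ as the Dehn twist $x\mapsto x+I(e_i,x)e_i$. This action is conjugate to the integral reduced Burau representation $\mathcal{B}_{-1}$ (the reduced Burau representation specialized at $t=-1$) and it preserves $I$. If $n=2l$ is even, $I$ is nondegenerate (unimodular) and $\rho_n$ is this action on $H$. If $n=2l+1$ is odd, the kernel of $I$ is a line $K$ on which the action is trivial,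 and $\rho_n$ is the induced action on $H/K$. In both cases, choosing a symplectic basis gives $\rho_n:B(n+1)\to Sp(2l,\mathbb{Z})$. Random walks. Probability measures are taken with finite support. The convolution of probability measures on a discrete group $G$ is $(\mu_1\star\mu_2)(g)=\sum_{h\in G}\mu_1(gh^{-1})\mu_2(h)$, and $\mu^{\star k}$ is the $k$-fold convolution of $\mu$ with itself. A probability measure $\mu$ on $G$ is nondegenerate if $\mathrm{supp}(\mu)$ generates $G$ as a semigroup. The right random $\mu$-walk is the Markov chain starting at the identity, whose probability of being in a subset $S\subset G$ at the $k$-th step is $\mu^{\star k}(S)$. A subset $S\subset G$ is transient for this walk if $\mu^{\star k}(S)\to 0$ as $k\to\infty$. *)

(* Defs.v *)
From HB Require Import structures.
From mathcomp Require Import all_boot all_order all_algebra.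
From mathcomp Require Import all_classical all_reals all_analysis.
From mathcomp Require mpoly.
From mathcomp Require Import ring zify.
Import GRing.Theory Num.Theory numFieldNormedType.Exports.

Set Implicit Arguments.
Unset Strict Implicit.
Unset Printing Implicit Defensive.

Local Open Scope classical_set_scope.
Local Open Scope ring_scope.

(* Artin's presentation of the group of braids with m strands: the letter
   (i, false) stands for the generator sigma_(i+1), (i, true) for its inverse. *)
Definition braid_word (m : nat) := seq ('I_m.-1 * bool).

Inductive braid_eqv (m : nat) : braid_word m -> braid_word m -> Prop :=
| Braid_refl w : braid_eqv w w
| Braid_sym u v : braid_eqv u v -> braid_eqv v u
| Braid_trans u v w : braid_eqv u v -> braid_eqv v w -> braid_eqv u w
| Braid_cat u u' v v' :
    braid_eqv u u' -> braid_eqv v v' -> braid_eqv (u ++ v) (u' ++ v')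
| Braid_inv i s : braid_eqv [:: (i, s); (i, ~~ s)] [::]
| Braid_far (i j : 'I_m.-1) : (i.+1 < j)%N ->
    braid_eqv [:: (i, false); (j, false)] [:: (j, false); (i, false)]
| Braid_near (i j : 'I_m.-1) : j = i.+1 :> nat ->
    braid_eqv [:: (i, false); (j, false); (i, false)]
              [:: (j, false); (i, false); (j, false)].

Definition braid_eqvb (m : nat) : rel (braid_word m) :=
  fun u v => `[< braid_eqv u v >].

Lemma braid_eqvb_refl m : reflexive (@braid_eqvb m).
Proof. by move=> w; apply/asboolP; exact: Braid_refl. Qed.

Lemma braid_eqvb_sym m : symmetric (@braid_eqvb m).
Proof. by move=> u v; apply/asboolP/asboolP; exact: Braid_sym. Qed.

Lemma braid_eqvb_trans m : transitive (@braid_eqvb m).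
Proof.
move=> v u w /asboolP uv /asboolP vw; apply/asboolP.
exact: Braid_trans uv vw.
Qed.

Canonical braid_equiv m := EquivRel (@braid_eqvb m)
  (@braid_eqvb_refl m) (@braid_eqvb_sym m) (@braid_eqvb_trans m).

Definition braid (m : nat) := {eq_quot (braid_equiv m)}%qT.
HB.instance Definition _ m := Choice.on (braid m).
HB.instance Definition _ m := EqQuotient.on (braid m).

Definition braid_of_word m (w : braid_word m) : braid m := \pi_(braid m)%qT w.

Lemma braid_of_wordP m (u v : braid_word m) :
  braid_of_word u = braid_of_word v <-> braid_eqv u v.
Proof.
split; last by move=> uv; apply/eqmodP/asboolP.
by move/eqmodP/asboolP.
Qed.

Lemma braid_of_wordK m (b : braid m) : braid_of_word (repr b) = b.
Proof. exact: reprK. Qed.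

Lemma repr_braid_eqv m (w : braid_word m) :
  braid_eqv (repr (braid_of_word w)) w.
Proof. by apply/braid_of_wordP; rewrite braid_of_wordK. Qed.

Definition word_inv m (w : braid_word m) : braid_word m :=
  rev [seq (a.1, ~~ a.2) | a <- w].

Lemma word_invK m : involutive (@word_inv m).
Proof.
move=> w; rewrite /word_inv map_rev revK -map_comp -[RHS]map_id.
by apply: eq_map => -[i s] /=; rewrite negbK.
Qed.

Lemma word_mulV m (w : braid_word m) : braid_eqv (w ++ word_inv w) [::].
Proof.
elim: w => [|[i s] w IHw]; first exact: Braid_refl.
rewrite /word_inv /= rev_cons -cats1 -/(word_inv w).
apply: (Braid_trans _ (Braid_inv i s)).
have -> : (i, s) :: w ++ word_inv w ++ [:: (i, ~~ s)] =
    [:: (i, s)] ++ (w ++ word_inv w) ++ [:: (i, ~~ s)] by rewrite -!catA.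
apply: (@Braid_cat _ _ [:: (i, s)] _ [:: (i, ~~ s)]); first exact: Braid_refl.
apply: (@Braid_cat _ _ [::] _ [:: (i, ~~ s)]); first exact: IHw.
exact: Braid_refl.
Qed.

Lemma word_Vmul m (w : braid_word m) : braid_eqv (word_inv w ++ w) [::].
Proof. by have := word_mulV (word_inv w); rewrite word_invK. Qed.

Definition braid_one m : braid m := braid_of_word [::].
Definition braid_mul m (a b : braid m) : braid m :=
  braid_of_word (repr a ++ repr b).
Definition braid_inv m (a : braid m) : braid m :=
  braid_of_word (word_inv (repr a)).

Lemma braid_mulE m (u v : braid_word m) :
  braid_mul (braid_of_word u) (braid_of_word v) = braid_of_word (u ++ v).
Proof. by apply/braid_of_wordP; apply: Braid_cat; exact: repr_braid_eqv. Qed.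

Lemma braid_mulA m : associative (@braid_mul m).
Proof.
move=> a b c; rewrite -[a]braid_of_wordK -[b]braid_of_wordK -[c]braid_of_wordK.
by rewrite !braid_mulE catA.
Qed.

Lemma braid_mul1 m : left_id (@braid_one m) (@braid_mul m).
Proof. by move=> a; rewrite -[a]braid_of_wordK braid_mulE. Qed.

Lemma braid_mulr1 m : right_id (@braid_one m) (@braid_mul m).
Proof. by move=> a; rewrite -[a]braid_of_wordK braid_mulE cats0. Qed.

Lemma braid_mulV m : left_inverse (@braid_one m) (@braid_inv m) (@braid_mul m).
Proof.
move=> a; rewrite -[X in braid_mul _ X]braid_of_wordK braid_mulE.
by apply/braid_of_wordP; exact: word_Vmul.
Qed.

Lemma braid_mulrV m :
  right_inverse (@braid_one m) (@braid_inv m) (@braid_mul m).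
Proof.
move=> a; rewrite -[X in braid_mul X _]braid_of_wordK braid_mulE.
by apply/braid_of_wordP; exact: word_mulV.
Qed.

HB.instance Definition _ m := isGroup.Build (braid m)
  (@braid_mulA m) (@braid_mul1 m) (@braid_mulr1 m)
  (@braid_mulV m) (@braid_mulrV m).

Definition sigma m (i : 'I_m.-1) : braid m := braid_of_word [:: (i, false)].

Definition basis_vec n (i : 'I_n) : 'cV[int]_n := delta_mx i 0.

Definition intersection_mx n : 'M[int]_n :=
  \matrix_(i, j) ((i.+1 == j)%:R - (j.+1 == i)%:R).

Definition iform n (x y : 'cV[int]_n) : int :=
  (x^T *m intersection_mx n *m y) 0 0.

(* The action of B(n+1) on H = Z^n by Dehn twists; a word w1 w2 acts by w1 after
   w2. *)
Definition dehn_twist n (i : 'I_n) (x : 'cV[int]_n) : 'cV[int]_n :=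
  x + iform (basis_vec i) x *: basis_vec i.

Definition dehn_untwist n (i : 'I_n) (x : 'cV[int]_n) : 'cV[int]_n :=
  x - iform (basis_vec i) x *: basis_vec i.

Definition letter_act n (a : 'I_n.+1.-1 * bool) (x : 'cV[int]_n) :
    'cV[int]_n :=
  if a.2 then dehn_untwist a.1 x else dehn_twist a.1 x.

Definition word_act n (w : braid_word n.+1) (x : 'cV[int]_n) : 'cV[int]_n :=
  foldr (@letter_act n) x w.

(* Independent of the representative, see [braid_act_word]. *)
Definition braid_act n (g : braid n.+1) (x : 'cV[int]_n) : 'cV[int]_n :=
  word_act (repr g) x.

Section Action.
Variable n : nat.
Implicit Types (x y z : 'cV[int]_n) (i j : 'I_n) (g h : braid n.+1).

Lemma iformDr x y z : iform x (y + z) = iform x y + iform x z.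
Proof. by rewrite /iform mulmxDr mxE. Qed.

Lemma iformDl x y z : iform (x + y) z = iform x z + iform y z.
Proof. by rewrite /iform linearD /= !mulmxDl mxE. Qed.

Lemma iformZr a x y : iform x (a *: y) = a * iform x y.
Proof. by rewrite /iform -scalemxAr mxE. Qed.

Lemma iformZl a x y : iform (a *: x) y = a * iform x y.
Proof. by rewrite /iform linearZ /= -!scalemxAl mxE. Qed.

Lemma iformNr x y : iform x (- y) = - iform x y.
Proof. by rewrite -scaleN1r iformZr mulN1r. Qed.

Lemma iformNl x y : iform (- x) y = - iform x y.
Proof. by rewrite -scaleN1r iformZl mulN1r. Qed.

Lemma intersection_mxT : (intersection_mx n)^T = - intersection_mx n.
Proof. by apply/matrixP => i j; rewrite !mxE opprB. Qed.

Lemma iformC x y : iform y x = - iform x y.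
Proof.
have -> : iform y x = ((y^T *m intersection_mx n *m x)^T) 0 0 by rewrite mxE.
by rewrite !trmx_mul trmxK intersection_mxT mulNmx mulmxN mulmxA mxE.
Qed.

Lemma iform_alt x : iform x x = 0.
Proof.
by have /eqP := iformC x x; rewrite -addr_eq0 -mulr2n mulrn_eq0 /= => /eqP.
Qed.

Lemma iform_basis i j :
  iform (basis_vec i) (basis_vec j) = (i.+1 == j)%:R - (j.+1 == i)%:R.
Proof.
by rewrite /iform /basis_vec trmx_delta -rowE -colE !mxE.
Qed.


Lemma letter_actD a x y :
  @letter_act n a (x + y) = letter_act a x + letter_act a y.
Proof.
by rewrite /letter_act /dehn_twist /dehn_untwist; case: a.2;
   rewrite iformDr scalerDl ?opprD addrACA.
Qed.

Lemma letter_actZ a (c : int) x :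
  @letter_act n a (c *: x) = c *: letter_act a x.
Proof.
by rewrite /letter_act /dehn_twist /dehn_untwist; case: a.2;
   rewrite iformZr -scalerA ?scalerBr ?scalerDr.
Qed.

Lemma letter_act_iform a x y :
  iform (@letter_act n a x) (letter_act a y) = iform x y.
Proof.
rewrite /letter_act /dehn_twist /dehn_untwist; case: a.2;
  rewrite !(iformDr, iformDl, iformNr, iformNl, iformZr, iformZl) iform_alt;
  rewrite (iformC (basis_vec a.1) x); ring.
Qed.

Lemma letter_actV i s x :
  @letter_act n (i, s) (letter_act (i, ~~ s) x) = x.
Proof.
rewrite /letter_act /dehn_twist /dehn_untwist; case: s => /=;
  rewrite !(iformDr, iformNr, iformZr) iform_alt mulr0 ?addr0 ?subr0.
  by rewrite addrK.
by rewrite subrK.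
Qed.

Lemma word_act_eqv (u v : braid_word n.+1) :
  braid_eqv u v -> word_act u =1 word_act v.
Proof.
elim=> {u v} [//|u v _ IH x|u v w _ IHu _ IHv x|u u' v v' _ IHu _ IHv x
  |i s x|i j ij x|i j ij x].
- by rewrite IH.
- by rewrite IHu.
- by rewrite /word_act !foldr_cat -!/(word_act _ _) IHu IHv.
- exact: letter_actV.
- rewrite /= /letter_act /= /dehn_twist !(iformDr, iformZr) !iform_basis.
  have h1 : (i.+1 == j) = false by rewrite ltn_eqF.
  have h2 : (j.+1 == i) = false by rewrite gtn_eqF // ltnW // leqW // ltnW.
  by rewrite h1 h2 subrr !mulr0 !addr0 addrAC.
- have eij : iform (basis_vec i) (basis_vec j) = 1 :> int.
    by rewrite iform_basis ij eqxx gtn_eqF ?subr0 // leqW.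
  have eji : iform (basis_vec j) (basis_vec i) = -1 :> int by rewrite iformC eij.
  rewrite /= /letter_act /= /dehn_twist.
  rewrite !(iformDr, iformZr) !iform_alt eij eji.
  set p := iform _ x; set q := iform _ x.
  by apply/matrixP => k l; rewrite !mxE; ring.
Qed.

Lemma braid_act_word (w : braid_word n.+1) x :
  braid_act (braid_of_word w) x = word_act w x.
Proof. by rewrite /braid_act (word_act_eqv (repr_braid_eqv w)). Qed.

Lemma braid_act_sigma i x : braid_act (@sigma n.+1 i) x = dehn_twist i x.
Proof. exact: braid_act_word. Qed.

Lemma braid_act1 x : braid_act (1%g : braid n.+1) x = x.
Proof. exact: braid_act_word. Qed.

Lemma braid_actM g h x : braid_act (g * h)%g x = braid_act g (braid_act h x).
Proof.
rewrite -[g]braid_of_wordK -[h]braid_of_wordK.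
rewrite -[(_ * _)%g]/(braid_mul _ _) braid_mulE !braid_act_word.
by rewrite /word_act foldr_cat.
Qed.

Lemma braid_actD g x y : braid_act g (x + y) = braid_act g x + braid_act g y.
Proof.
rewrite /braid_act /word_act.
by elim: (repr g) => //= a w ->; exact: letter_actD.
Qed.

Lemma braid_actZ g (c : int) x : braid_act g (c *: x) = c *: braid_act g x.
Proof.
rewrite /braid_act /word_act.
by elim: (repr g) => //= a w ->; exact: letter_actZ.
Qed.

Lemma braid_act_iform g x y : iform (braid_act g x) (braid_act g y) = iform x y.
Proof.
rewrite /braid_act /word_act.
by elim: (repr g) => //= a w IH; rewrite letter_act_iform.
Qed.

End Action.

Definition in_kernel n (x : 'cV[int]_n) : Prop :=
  forall y, iform x y = 0.

(* Gram matrix of a symplectic basis a_1, ..., a_l, b_1, ..., b_l with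
   I(a_i, b_j) = delta_ij. *)
Definition symp_mx l : 'M[int]_(l + l) := block_mx 0 1%:M (- 1%:M) 0.

Definition Sp l : set 'M[int]_(l + l) :=
  [set M | M^T *m symp_mx l *m M = symp_mx l].
Arguments Sp : clear implicits.

(* A symplectic basis of H/K, with K the kernel of the form, given by lifts to
   H of its vectors. For n even K = 0 (see [in_kernel_even]), so that it is a
   symplectic basis of H. *)
Record symplectic_basis n := SymplecticBasis {
  sb_vec :> 'I_(n./2 + n./2) -> 'cV[int]_n;
  sb_basis : forall x, exists! c : 'cV[int]_(n./2 + n./2),
    in_kernel (x - \sum_j c j 0 *: sb_vec j);
  sb_symp : forall i j, iform (sb_vec i) (sb_vec j) = symp_mx n./2 i j }.

Definition sb_coord n (b : symplectic_basis n) (x : 'cV[int]_n) :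
    'cV[int]_(n./2 + n./2) :=
  projT1 (cid (sb_basis b x)).

(* Column j consists of the coordinates of the image of the j-th vector. *)
Definition symplectic_rep n (b : symplectic_basis n) (g : braid n.+1) :
    'M[int]_(n./2 + n./2) :=
  \matrix_(i, j) sb_coord b (braid_act g (b j)) i 0.

Definition eval_at_mx d (P : mpoly.mpoly (d * d) int) (M : 'M[int]_d) : int :=
  mpoly.meval (fun k => mxvec M 0 k) P.

Section SymplecticRep.
Variables (n : nat) (b : symplectic_basis n).
Implicit Types (x y : 'cV[int]_n) (g h : braid n.+1).

Lemma in_kernelP x :
  in_kernel x <-> forall i, iform (basis_vec i) x = 0.
Proof.
split=> [kx i|kx y]; first by rewrite iformC kx oppr0.
rewrite iformC; apply/eqP; rewrite oppr_eq0; apply/eqP.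
have -> : y = \sum_i y i 0 *: basis_vec i.
  apply/matrixP => i j; rewrite ord1 summxE (bigD1 i) //= big1 => [|k ki].
    by rewrite !mxE !eqxx mulr1 addr0.
  by rewrite !mxE (negbTE (_ : i != k)) ?mulr0 // eq_sym.
rewrite (big_morph (fun z => iform z x) (fun z t => iformDl z t x)
  (_ : iform 0 x = 0)); last by rewrite -(scale0r 0) iformZl mul0r.
by apply: big1 => i _; rewrite iformZl kx mulr0.
Qed.

Lemma in_kernelB x y : in_kernel x -> in_kernel y -> in_kernel (x - y).
Proof. by move=> kx ky z; rewrite iformDl iformNl kx ky subrr. Qed.

Lemma in_kernelD x y : in_kernel x -> in_kernel y -> in_kernel (x + y).
Proof. by move=> kx ky z; rewrite iformDl kx ky addr0. Qed.

Lemma in_kernelZ (c : int) x : in_kernel x -> in_kernel (c *: x).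
Proof. by move=> kx z; rewrite iformZl kx mulr0. Qed.

Lemma in_kernel0 : in_kernel (0 : 'cV[int]_n).
Proof. by move=> z; rewrite -(scale0r 0) iformZl mul0r. Qed.

Lemma in_kernel_sum (I : Type) (r : seq I) (F : I -> 'cV[int]_n) :
  (forall i, in_kernel (F i)) -> in_kernel (\sum_(i <- r) F i).
Proof.
by move=> kF; apply: big_ind => //; [exact: in_kernel0|exact: in_kernelD].
Qed.

Lemma braid_act_kernel g x : in_kernel x -> braid_act g x = x.
Proof.
move=> /in_kernelP kx; rewrite /braid_act /word_act.
elim: (repr g) => //= a w ->.
by rewrite /letter_act /dehn_twist /dehn_untwist kx scale0r subr0 addr0 if_same.
Qed.

Lemma sb_coordP x : in_kernel (x - \sum_j sb_coord b x j 0 *: b j).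
Proof. by rewrite /sb_coord; case: cid => c [] /=. Qed.

Lemma sb_coord_uniq x (c : 'cV[int]_(n./2 + n./2)) :
  in_kernel (x - \sum_j c j 0 *: b j) -> sb_coord b x = c.
Proof. by rewrite /sb_coord; case: cid => d [] /= _; apply. Qed.

Lemma braid_act_sum g (I : Type) (r : seq I) (F : I -> 'cV[int]_n) :
  braid_act g (\sum_(i <- r) F i) = \sum_(i <- r) braid_act g (F i).
Proof.
apply: (big_morph (braid_act g) (braid_actD g)).
by rewrite -(scale0r 0) braid_actZ !scale0r.
Qed.

Lemma symplectic_repP g j :
  in_kernel (braid_act g (b j) - \sum_i symplectic_rep b g i j *: b i).
Proof. by under eq_bigr do rewrite mxE; exact: sb_coordP. Qed.

Lemma symplectic_rep_uniq g (M : 'M[int]_(n./2 + n./2)) :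
  (forall j, in_kernel (braid_act g (b j) - \sum_i M i j *: b i)) ->
  symplectic_rep b g = M.
Proof.
move=> gM; apply/matrixP => i j; rewrite mxE.
rewrite (@sb_coord_uniq _ (col j M)) ?mxE //.
by under eq_bigr do rewrite mxE; exact: gM.
Qed.

Lemma symplectic_rep1 : symplectic_rep b 1%g = 1%:M.
Proof.
apply: symplectic_rep_uniq => j; rewrite braid_act1 (bigD1 j) //= big1.
  by rewrite mxE eqxx scale1r addr0 subrr; exact: in_kernel0.
by move=> i ij; rewrite mxE (negbTE ij) scale0r.
Qed.

Lemma symplectic_repM g h :
  symplectic_rep b (g * h)%g = symplectic_rep b g *m symplectic_rep b h.
Proof.
apply: symplectic_rep_uniq => j; rewrite braid_actM.
pose S := \sum_i symplectic_rep b h i j *: b i.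
have -> : braid_act h (b j) = (braid_act h (b j) - S) + S by rewrite subrK.
rewrite braid_actD (braid_act_kernel _ (symplectic_repP h j)) -addrA.
apply: in_kernelD; first exact: symplectic_repP.
rewrite /S braid_act_sum.
have -> : \sum_i (symplectic_rep b g *m symplectic_rep b h) i j *: b i =
    \sum_k symplectic_rep b h k j *: \sum_i symplectic_rep b g i k *: b i.
  under eq_bigr do rewrite mxE scaler_suml.
  rewrite exchange_big /=; apply: eq_bigr => k _; rewrite scaler_sumr.
  by apply: eq_bigr => i _; rewrite scalerA mulrC.
rewrite -sumrB; apply: in_kernel_sum => k; rewrite braid_actZ -scalerBr.
by apply: in_kernelZ; exact: symplectic_repP.
Qed.

Lemma iform_kerl x x' y : in_kernel (x - x') -> iform x y = iform x' y.
Proof. by move=> /(_ y) /eqP; rewrite iformDl iformNl subr_eq0 => /eqP. Qed.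

Lemma symplectic_rep_Sp g : Sp n./2 (symplectic_rep b g).
Proof.
apply/matrixP => i j; rewrite -(sb_symp b) -(braid_act_iform g).
rewrite (iform_kerl _ (symplectic_repP g i)) iformC.
rewrite (iform_kerl _ (symplectic_repP g j)) -iformC.
have suml (I : finType) (F : I -> 'cV[int]_n) y :
    iform (\sum_i F i) y = \sum_i iform (F i) y.
  apply: (big_morph (fun z => iform z y) (fun z t => iformDl z t y)).
  by rewrite -(scale0r 0) iformZl mul0r.
have sumr (I : finType) (F : I -> 'cV[int]_n) y :
    iform y (\sum_i F i) = \sum_i iform y (F i).
  by apply: (big_morph (iform y) (iformDr y)); rewrite -(scale0r 0) iformZr mul0r.
rewrite sumr mxE; apply: eq_bigr => k _; rewrite suml mxE mulr_suml.
apply: eq_bigr => m _; rewrite iformZr iformZl sb_symp mxE; ring.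
Qed.

Lemma symplectic_rep_sigma i j :
  in_kernel (dehn_twist i (b j) -
    \sum_k symplectic_rep b (@sigma n.+1 i) k j *: b k).
Proof. by rewrite -braid_act_sigma; exact: symplectic_repP. Qed.

End SymplecticRep.

Section SymplecticBasis.
Variable n : nat.
Implicit Types x y : 'cV[int]_n.

Let coef x (k : nat) : int := if insub k is Some i then x i 0 else 0.

Let coefE x (i : 'I_n) : coef x i = x i 0.
Proof. by rewrite /coef valK. Qed.

Let coef_out x k : (n <= k)%N -> coef x k = 0.
Proof. by move=> nk; rewrite /coef insubF // ltnNge nk. Qed.

Let sum_coef x k : \sum_(i < n) (i == k :> nat)%:R * x i 0 = coef x k.
Proof.
have [kn|nk] := ltnP k n.
  rewrite (bigD1 (Ordinal kn)) //= eqxx mul1r big1 ?addr0.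
    by rewrite -coefE.
  by move=> i; rewrite -val_eqE /= => /negbTE ->; rewrite mul0r.
rewrite coef_out // big1 // => i _.
by rewrite ltn_eqF ?mul0r // (leq_trans (ltn_ord i)).
Qed.

Let iform_coef (i : 'I_n) x :
  iform (basis_vec i) x =
  coef x i.+1 - (if i : nat is k.+1 then coef x k else 0).
Proof.
rewrite /iform /basis_vec trmx_delta -rowE !mxE.
under eq_bigr do rewrite !mxE mulrBl.
rewrite sumrB; congr (_ - _);
  first by under eq_bigr do rewrite eq_sym; exact: sum_coef.
case: (i : nat) => [|k]; first by apply: big1 => j _; rewrite mul0r.
by under eq_bigr do rewrite eqSS; exact: sum_coef.
Qed.

Let kernel_step x : in_kernel x ->
  forall k, (k.+1 < n)%N -> coef x k = coef x k.+2.
Proof.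
move=> kx k kn; have /in_kernelP/(_ (Ordinal kn)) := kx.
by rewrite iform_coef /= => /eqP; rewrite subr_eq0 => /eqP.
Qed.

Lemma in_kernel_even x : ~~ odd n -> in_kernel x -> x = 0.
Proof.
move=> n_even kx.
have odd0 k : (k.*2.+1 < n)%N -> coef x k.*2.+1 = 0.
  elim: k => [|k IHk] kn.
    have /in_kernelP/(_ (Ordinal (ltnW kn))) := kx.
    by rewrite iform_coef /= subr0.
  rewrite doubleS -kernel_step //; first by apply: IHk; do 2 apply: ltnW.
  by rewrite -doubleS ltnW.
have even0 m k : (n <= k.*2 + m.*2)%N -> coef x k.*2 = 0.
  elim: m k => [|m IHm] k nkm; first by rewrite coef_out // -[k.*2]addn0.
  have [kn|nk] := ltnP k.*2.+1 n.
    rewrite kernel_step // -doubleS IHm // (leq_trans nkm) //.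
    by rewrite !doubleS !addSn !addnS.
  have [|nk2] := leqP n k.*2; first exact: coef_out.
  have nE : n = k.*2.+1 by apply/eqP; rewrite eqn_leq nk nk2.
  by move: n_even; rewrite nE /= odd_double.
apply/matrixP => i j; rewrite ord1 mxE -coefE; have := ltn_ord i => i_n.
case: (boolP (odd i)) => oi.
  have -> : nat_of_ord i = i./2.*2.+1 by lia.
  by apply: odd0; lia.
have -> : nat_of_ord i = i./2.*2 by lia.
by apply: (even0 n); lia.
Qed.

Let l := n./2.

Let avec (k : 'I_l) : 'cV[int]_n := \col_i (~~ odd i && (i <= k.*2)%N)%:R.

Let odd_lt (k : 'I_l) : (k.*2.+1 < n)%N.
Proof.
rewrite -[n]odd_double_half ltn_addl // -[X in (X <= _)%N]doubleS leq_double.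
exact: ltn_ord.
Qed.

Let bvec (k : 'I_l) : 'cV[int]_n := basis_vec (Ordinal (odd_lt k)).

Let std_vec (i : 'I_(l + l)) : 'cV[int]_n :=
  match fintype.split i with inl k => avec k | inr k => bvec k end.

Let avec_coef m k : coef (avec m) k = (~~ odd k && (k <= m.*2)%N)%:R.
Proof.
have [kn|nk] := ltnP k n; first by rewrite -[k]/(val (Ordinal kn)) coefE mxE.
rewrite coef_out // [(k <= _)%N]leqNgt (leq_trans _ nk) ?andbF //.
by rewrite ltnW // odd_lt.
Qed.

Let iform_expand x y : iform x y = \sum_i x i 0 * iform (basis_vec i) y.
Proof.
rewrite {1}/iform -mulmxA mxE; apply: eq_bigr => i _; rewrite mxE; congr (_ * _).
by rewrite /iform /basis_vec trmx_delta -mulmxA -rowE [RHS]mxE.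
Qed.

Let iform_ea (j : 'I_n) m :
  iform (basis_vec j) (avec m) = - (j == m.*2.+1 :> nat)%:R.
Proof.
rewrite iform_coef; case: (j : nat) => [|k];
  rewrite !avec_coef /= ?subrr ?oppr0 //.
rewrite negbK eqSS; have [->|km] := eqVneq k m.*2.
  by rewrite odd_double leqnn ltnNge leqnSn /= sub0r.
apply/eqP; rewrite oppr0 subr_eq0; apply/eqP; congr ((nat_of_bool _)%:R); lia.
Qed.

Let iform_ba (k m : 'I_l) : iform (bvec k) (avec m) = - (m == k)%:R.
Proof.
by rewrite iform_ea /= eqSS (inj_eq double_inj) [in RHS]eq_sym.
Qed.

Let iform_aa (k m : 'I_l) : iform (avec k) (avec m) = 0.
Proof.
rewrite /iform mxE big1 // => j _; rewrite !mxE.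
case: (boolP (odd j)) => oj; first by rewrite mulr0.
rewrite [X in X * _]big1 ?mul0r // => i _; rewrite !mxE.
case: (boolP (odd i)) => oi; first by rewrite mul0r.
have neq (p q : nat) : ~~ odd p -> ~~ odd q -> (p.+1 == q) = false.
  by move=> op oq; apply: contraNF oq => /eqP <- /=.
by rewrite !neq // subrr mulr0.
Qed.

Let iform_bb (k m : 'I_l) : iform (bvec k) (bvec m) = 0.
Proof.
have neq (p q : nat) : (p.*2.+2 == q.*2.+1) = false.
  by apply/negP => /eqP/(congr1 odd); rewrite /= !odd_double.
by rewrite iform_basis /= !neq subrr.
Qed.

Let std_symp i j : iform (std_vec i) (std_vec j) = symp_mx l i j.
Proof.
rewrite /std_vec /symp_mx !mxE; case: fintype.split => k; rewrite !mxE;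
  case: fintype.split => m; rewrite ?mxE ?iform_aa ?iform_bb //.
  by rewrite iformC iform_ba opprK.
by rewrite iform_ba eq_sym.
Qed.

Let std_ortho y : (forall i, iform (std_vec i) y = 0) -> in_kernel y.
Proof.
move=> oy.
have oa (k : 'I_l) : iform (avec k) y = 0.
  by have := oy (lshift l k); rewrite /std_vec (unsplitK (inl k)).
have ob (k : 'I_l) : iform (bvec k) y = 0.
  by have := oy (rshift l k); rewrite /std_vec (unsplitK (inr k)).
have odd0 k : coef y k.*2.+1 = 0.
  have [kn|nk] := ltnP k.*2.+1 n; last exact: coef_out.
  have kl : (k < l)%N by rewrite /l; lia.
  have := oa (Ordinal kl); rewrite iformC iform_expand.
  under eq_bigr do rewrite iform_ea mulrN mulrC.
  by rewrite sumrN opprK sum_coef.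
apply/in_kernelP => i; have i_n := ltn_ord i; case: (boolP (odd i)) => oi.
  have il : (i./2 < l)%N by rewrite /l; lia.
  rewrite (_ : basis_vec i = bvec (Ordinal il)) ?ob // /bvec; congr basis_vec.
  by apply: val_inj => /=; lia.
rewrite iform_coef; have -> : i = i./2.*2 :> nat by lia.
by rewrite odd0; case: i./2 => [|k]; rewrite ?doubleS ?odd0 subrr.
Qed.

Let symp_mx_inv : - symp_mx l *m symp_mx l = 1%:M.
Proof.
rewrite mulNmx /symp_mx mulmx_block !(mul0mx, mulmx0, mul1mx, mulmx1).
rewrite !(add0r, addr0) opp_block_mx !opprK oppr0.
by rewrite -scalar_mx_block.
Qed.

Let std_basis x :
  exists! c : 'cV[int]_(l + l), in_kernel (x - \sum_j c j 0 *: std_vec j).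
Proof.
pose v : 'cV[int]_(l + l) := \col_i iform (std_vec i) x.
have sumr (c : 'cV[int]_(l + l)) i :
    iform (std_vec i) (\sum_j c j 0 *: std_vec j) = (symp_mx l *m c) i 0.
  rewrite (big_morph (iform (std_vec i)) (iformDr _) (_ : _ = 0)).
    by rewrite mxE; apply: eq_bigr => j _; rewrite iformZr std_symp mulrC.
  by rewrite -(scale0r 0) iformZr mul0r.
exists (- symp_mx l *m v); split=> [|c kc].
  apply: std_ortho => i; rewrite iformDr iformNr sumr mulmxA mulmxN -mulNmx.
  by rewrite symp_mx_inv mul1mx mxE subrr.
rewrite (_ : v = symp_mx l *m c) ?mulmxA ?symp_mx_inv ?mul1mx //.
apply/matrixP => i j; rewrite ord1 -sumr mxE; apply/eqP.
by rewrite -subr_eq0 -iformNr -iformDr iformC kc oppr0.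
Qed.

Lemma symplectic_basis_exists : inhabited (symplectic_basis n).
Proof. by constructor; exact: SymplecticBasis std_basis std_symp. Qed.

End SymplecticBasis.

Definition supp (R : realType) (G : choiceType) (mu : G -> R) : set G :=
  [set g | mu g != 0].

Definition fs_probability (R : realType) (G : choiceType) (mu : G -> R) :
    Prop :=
  [/\ forall g, 0 <= mu g, finite_set (supp mu) &
      \sum_(g \in [set: G]) mu g = 1].

Definition nondegenerate_measure (R : realType) (G : groupType) (mu : G -> R) :
    Prop :=
  smallest [set A : set G | forall x y, A x -> A y -> A (x * y)%g] (supp mu)
    = [set: G].

Definition convolution (R : realType) (G : groupType) (mu1 mu2 : G -> R) :
    G -> R :=
  fun g => \sum_(h \in [set: G]) mu1 (g * h^-1)%g * mu2 h.

Definition convolution_pow (R : realType) (G : groupType) (mu : G -> R)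
    (k : nat) : G -> R :=
  iter k (convolution mu) (fun g => (g == 1%g)%:R).

Definition transient (R : realType) (G : groupType) (mu : G -> R)
    (S : set G) : Prop :=
  (\sum_(g \in S) convolution_pow mu k g) @[k --> \oo] --> (0 : R).

(* A big operator over a set has a junk value when its support is infinite; this
   never happens above when mu has finite support. *)
Lemma convolution_pow_supp (R : realType) (G : groupType) (mu : G -> R) k :
  finite_set (supp mu) -> finite_set (supp (convolution_pow mu k)).
Proof.
move=> fmu; elim: k => [|k IHk].
  apply: (@sub_finite_set _ _ [set 1%g]); last exact: finite_set1.
  by move=> g; rewrite /supp /=; case: (g =P 1%g) => // _ /eqP.
apply: (@sub_finite_set _ _
  [set (x * y)%g | x in supp mu & y in supp (convolution_pow mu k)]).
  move=> g /= gN0; apply: contrapT => Ng; move: gN0; rewrite /supp /=.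
  apply/negP; rewrite negbK; apply/eqP; rewrite /convolution fsbig1 // => h _.
  apply: contrapT => /eqP; rewrite mulf_eq0 negb_or => /andP[xN0 hN0]; apply: Ng.
  by exists (g * h^-1)%g => //; exists h => //; rewrite -mulgA mulVg mulg1.
exact: finite_image2.
Qed.

(* Main.v *)
Require Import Defs.
From HB Require Import structures.
From mathcomp Require Import all_boot all_order all_algebra.
From mathcomp Require Import all_classical all_reals all_analysis.
From mathcomp Require mpoly.
From mathcomp Require Import mxtens ring lra.
Import Order.TTheory GRing.Theory Num.Theory numFieldNormedType.Exports.
Set Implicit Arguments.
Unset Strict Implicit.
Unset Printing Implicit Defensive.
Local Open Scope classical_set_scope.
Local Open Scope ring_scope.

(** The theorem holds because the random walk charges a proper algebraic subset
    of Sp persistently only if some proper algebraic subset contains the image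
    of a coset of a submonoid of braids with a positive power of every
    [sigma i] in it, and such a submonoid has a Zariski dense image.

    Linearisation. A polynomial in the entries of a matrix is a matrix
    coefficient of a polynomial representation of the matrix monoid
    ([polyfun_matrix_coefficient]). Hence there are vectors [phi g] and
    matrices [A x] with [phi (x * h) = phi h *m A x], and a subspace [U], such
    that [P (rho g) = 0] if and only if [phi g] lies in [U]. Linear subspaces
    thus take the place of algebraic subsets: two distinct subspaces of the
    same dimension meet in a smaller one.

    Non-concentration ([subspace_mass_to0]). By induction on [d], the largest
    probability that [phi] of the walk lies in a subspace of dimension at most
    [d] that does not contain all of [phi] tends to 0. This maximum decreases
    with time, as the mass of [U] at time [k+1] is an average of masses at time
    [k] of translates of [U]. If its limit [c] is positive, take a late time
    [k], a fixed [r], and [U] of nearly maximal mass at time [k+r]. All the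
    translates of [U] by products of [r] elements of the support then have mass
    at least [c/2] at time [k]. By the induction hypothesis distinct translates
    almost do not overlap, so they are fewer than [6/c+1]. With [r] large,
    enough powers of each [sigma i] are products of exactly [r] elements of the
    support, because the identity is a product of some [q > 0] of them and can
    serve as padding; by the pigeonhole principle a positive power of each
    [sigma i] stabilises [U].

    Zariski density ([rho_zariski_dense]). Let [H] be a submonoid of the braid
    group that contains a positive power of each [sigma i]. The element [sigma
    i] acts as a transvection, with powers [x |-> x + N I(e_i, x) e_i],
    polynomial in [N], so the closure of [rho H] contains the whole
    one-parameter group of transvections along [e_i]. Consecutive [e_i] pair to
    1, and conjugating transvections by each other gives the transvections
    along all vectors ([root_span]). These generate the symplectic group
    ([isometry_transvection_ind]), so the closure contains it. For [H] the
    stabiliser of [U] this shows that [U], as soon as it contains one [phi g],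
    contains all of them; for [H] the whole group it shows that [P], which is
    not identically zero on Sp, is not identically zero on the image of [rho]. *)

(** * Polynomial functions on matrices *)

(** Polynomials as functions, so that restriction, translation and
    linearisation are all done by induction on how the function is built. *)
Inductive polyfun (F : comNzRingType) d : ('M[F]_d -> F) -> Prop :=
| polyfun_cst c : polyfun (fun=> c)
| polyfun_coord i j : polyfun (fun M => M i j)
| polyfun_add f g : polyfun f -> polyfun g -> polyfun (fun M => f M + g M)
| polyfun_mul f g : polyfun f -> polyfun g -> polyfun (fun M => f M * g M).

Section PolynomialFunctions.
Variables (F : comNzRingType) (d : nat).
Implicit Types (f g : 'M[F]_d -> F) (A M N : 'M[F]_d).

Lemma eq_polyfun f g : f =1 g -> polyfun f -> polyfun g.
Proof. by move=> /funext ->. Qed.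

Lemma polyfun_sum (I : Type) (r : seq I) (f : I -> 'M[F]_d -> F) :
  (forall i, polyfun (f i)) -> polyfun (fun M => \sum_(i <- r) f i M).
Proof.
move=> pf; elim: r => [|i r IHr].
  by apply: eq_polyfun (polyfun_cst _ 0) => M; rewrite big_nil.
apply: eq_polyfun (polyfun_add (pf i) IHr) => M; by rewrite big_cons.
Qed.

Lemma polyfun_prod (I : Type) (r : seq I) (f : I -> 'M[F]_d -> F) :
  (forall i, polyfun (f i)) -> polyfun (fun M => \prod_(i <- r) f i M).
Proof.
move=> pf; elim: r => [|i r IHr].
  by apply: eq_polyfun (polyfun_cst _ 1) => M; rewrite big_nil.
apply: eq_polyfun (polyfun_mul (pf i) IHr) => M; by rewrite big_cons.
Qed.

Lemma polyfun_exp f k : polyfun f -> polyfun (fun M => f M ^+ k).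
Proof.
move=> pf; elim: k => [|k IHk]; first exact: polyfun_cst.
apply: eq_polyfun (polyfun_mul pf IHk) => M; by rewrite exprS.
Qed.

Lemma polyfun_comp (h : 'M[F]_d -> 'M[F]_d) f :
  (forall i j, polyfun (fun M => h M i j)) -> polyfun f ->
  polyfun (fun M => f (h M)).
Proof.
move=> ph; elim=> {f} [c|i j|f g _ IHf _ IHg|f g _ IHf _ IHg].
- exact: polyfun_cst.
- exact: ph.
- exact: polyfun_add.
- exact: polyfun_mul.
Qed.

Lemma polyfun_mulmxl A f : polyfun f -> polyfun (fun M => f (A *m M)).
Proof.
apply: polyfun_comp => i j.
apply: (@eq_polyfun (fun M => \sum_k A i k * M k j)) => [M|].
  by rewrite mxE.
apply: polyfun_sum => k; apply: polyfun_mul; first exact: polyfun_cst.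
exact: polyfun_coord.
Qed.

Lemma polyfun_mulmxr A f : polyfun f -> polyfun (fun M => f (M *m A)).
Proof.
apply: polyfun_comp => i j.
apply: (@eq_polyfun (fun M => \sum_k M i k * A k j)) => [M|].
  by rewrite mxE.
apply: polyfun_sum => k; apply: polyfun_mul; last exact: polyfun_cst.
exact: polyfun_coord.
Qed.

(** Quadratic curves suffice for what follows: a transvection along [v] is
    quadratic in [v] and affine in its parameter. *)
Lemma polyfun_quadratic_curve A B C f : polyfun f ->
  exists q : {poly F}, forall s, f (A + s *: B + s ^+ 2 *: C) = q.[s].
Proof.
elim=> {f} [c|i j|f g _ [p pE] _ [q qE]|f g _ [p pE] _ [q qE]].
- by exists c%:P => s; rewrite hornerC.
- exists ((A i j)%:P + (B i j)%:P * 'X + (C i j)%:P * ('X * 'X)) => s.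
  by rewrite !mxE !(hornerD, hornerM, hornerC, hornerX); ring.
- by exists (p + q) => s; rewrite hornerD pE qE.
- by exists (p * q) => s; rewrite hornerM pE qE.
Qed.

(** Matrix coefficients of representations contain the constants and the
    entries, and they are closed under addition (direct sum) and multiplication
    (tensor product).  The entries of the representation are kept polynomial so
    that conditions on it can be transported along Zariski closures. *)
Lemma polyfun_matrix_coefficient f : polyfun f ->
  exists m (R : 'M[F]_d -> 'M[F]_m) (u : 'rV[F]_m) (c : 'cV[F]_m),
  [/\ R 1%:M = 1%:M, forall M N, R (M *m N) = R M *m R N,
      forall i j, polyfun (fun M => R M i j) &
      forall M, f M = (u *m R M *m c) 0 0].
Proof.
elim=> {f} [c|i j|f g _ [m [R [u [c [R1 RM pR fE]]]]]
                      _ [n [S [v [e [S1 SM pS gE]]]]]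
                 |f g _ [m [R [u [c [R1 RM pR fE]]]]]
                      _ [n [S [v [e [S1 SM pS gE]]]]]].
- exists 1%N, (fun=> 1%:M), 1%:M, c%:M; split=> //.
  + by move=> M N; rewrite mulmx1.
  + by move=> i j; exact: polyfun_cst.
  + by move=> M; rewrite !mul1mx mxE eqxx.
- exists d, id, (delta_mx 0 i), (delta_mx j 0); split=> //.
  + by move=> k l; exact: polyfun_coord.
  + by move=> M; rewrite -rowE -colE !mxE.
- exists (m + n)%N, (fun M => block_mx (R M) 0 0 (S M)),
    (row_mx u v), (col_mx c e); split.
  + by rewrite R1 S1 -scalar_mx_block.
  + by move=> M N; rewrite mulmx_block RM SM !(mulmx0, mul0mx, addr0, add0r).
  + move=> i j; case: (split_ordP i) => k ->; case: (split_ordP j) => l ->.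
    * by apply: eq_polyfun (pR k l) => M; rewrite block_mxEul.
    * by apply: eq_polyfun (polyfun_cst _ 0) => M; rewrite block_mxEur mxE.
    * by apply: eq_polyfun (polyfun_cst _ 0) => M; rewrite block_mxEdl mxE.
    * by apply: eq_polyfun (pS k l) => M; rewrite block_mxEdr.
  + move=> M; rewrite mul_row_block !mulmx0 addr0 add0r mul_row_col mxE.
    by rewrite fE gE.
- exists (m * n)%N, (fun M => tensmx (R M) (S M)), (tensmx u v : 'rV_(m * n)),
    (tensmx c e : 'cV_(m * n)); split.
  + apply/matrixP => i j; rewrite R1 S1.
    case: (mxtens_indexP i) => i1 i2; case: (mxtens_indexP j) => j1 j2.
    rewrite tensmxE !mxE (can_eq (@mxtens_indexK m n)) xpair_eqE.
    by rewrite -natrM mulnb.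
  + by move=> M N; rewrite RM SM tensmx_mul.
  + move=> i j; case: (mxtens_indexP i) => i1 i2.
    case: (mxtens_indexP j) => j1 j2.
    apply: eq_polyfun (polyfun_mul (pR i1 j1) (pS i2 j2)) => M.
    by rewrite tensmxE.
  + move=> M; have i0 : mxtens_index ((0, 0) : 'I_1 * 'I_1) = 0 :> 'I_1.
      exact/val_inj.
    have := tensmxE (u *m R M *m c) (v *m S M *m e) 0 0 0 0.
    by rewrite fE gE -!tensmx_mul i0 => <-.
Qed.

End PolynomialFunctions.

(** * Zariski closure *)
Definition zariski_closure (F : comNzRingType) d (S : 'M[F]_d -> Prop)
    (M : 'M[F]_d) : Prop :=
  forall f, polyfun f -> (forall X, S X -> f X = 0) -> f M = 0.

Section ZariskiClosure.
Variables (F : numFieldType) (d : nat) (S : 'M[F]_d -> Prop).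
Local Notation Z := (zariski_closure S).

(** Polynomiality is used once per factor: first [X] is fixed in [S] and the
    left factor moves to the closure, then the left factor is fixed. *)
Lemma zariski_closure_mul :
  (forall M N, S M -> S N -> S (M *m N)) ->
  forall M N, Z M -> Z N -> Z (M *m N).
Proof.
move=> SM M N ZM ZN f pf f0.
apply: (ZN (fun X => f (M *m X)) (polyfun_mulmxl M pf)) => X SX.
apply: (ZM (fun Y => f (Y *m X)) (polyfun_mulmxr X pf)) => Y SY.
exact/f0/SM.
Qed.

(** A polynomial in one variable that vanishes at infinitely many points is
    zero. *)
Lemma zariski_closure_curve (A B C : 'M[F]_d) (u : nat -> F) :
  injective u -> (forall k, Z (A + u k *: B + u k ^+ 2 *: C)) ->
  forall s, Z (A + s *: B + s ^+ 2 *: C).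
Proof.
move=> u_inj Zu s f pf f0; have [q qE] := polyfun_quadratic_curve A B C pf.
suff q0 : q = 0 by rewrite qE q0 horner0.
apply/eqP/contraT => qN0.
have := @max_poly_roots _ q [seq u k | k <- iota 0 (size q)] qN0.
rewrite size_map size_iota ltnn map_inj_uniq ?iota_uniq //.
apply=> //; apply/allP => _ /mapP[k _ ->].
by rewrite rootE -qE (Zu k f).
Qed.

End ZariskiClosure.
(** * Transvections generate the symplectic group *)
Section Transvections.
Variables (F : numFieldType) (d : nat) (J : 'M[F]_d).
Hypothesis JT : J^T = - J.
Implicit Types (x y v w : 'cV[F]_d) (s t : F) (M : 'M[F]_d).

Definition form x y : F := (x^T *m J *m y) 0 0.
Definition transvection v s : 'M[F]_d := 1%:M + s *: (v *m (v^T *m J)).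
Definition isometry M := M^T *m J *m M = J.

Lemma mul_form x y : x^T *m J *m y = (form x y)%:M.
Proof. exact: mx11_scalar. Qed.

Lemma formDl x y z : form (x + y) z = form x z + form y z.
Proof. by rewrite /form linearD /= !mulmxDl mxE. Qed.

Lemma formDr x y z : form z (x + y) = form z x + form z y.
Proof. by rewrite /form mulmxDr mxE. Qed.

Lemma formZl s x y : form (s *: x) y = s * form x y.
Proof. by rewrite /form linearZ /= -!scalemxAl mxE. Qed.

Lemma formZr s x y : form x (s *: y) = s * form x y.
Proof. by rewrite /form -scalemxAr mxE. Qed.

Lemma formNl x y : form (- x) y = - form x y.
Proof. by rewrite -scaleN1r formZl mulN1r. Qed.

Lemma formNr x y : form x (- y) = - form x y.
Proof. by rewrite -scaleN1r formZr mulN1r. Qed.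

Lemma formC x y : form y x = - form x y.
Proof.
have -> : form y x = (y^T *m J *m x)^T 0 0 by rewrite mxE.
by rewrite !trmx_mul trmxK JT mulNmx mulmxN mulmxA mxE.
Qed.

Lemma form_alt x : form x x = 0.
Proof.
by have /eqP := formC x x; rewrite -addr_eq0 -mulr2n mulrn_eq0 /= => /eqP.
Qed.

Lemma form_nondegenerate x : J \in unitmx -> x != 0 -> exists y, form y x != 0.
Proof.
move=> uJ xN0; have /cV0Pn[i Ni] : J *m x != 0.
  by apply: contraNneq xN0 => Jx0; rewrite -(mulKmx uJ x) Jx0 mulmx0.
by exists (delta_mx i 0); rewrite /form trmx_delta -mulmxA -rowE mxE.
Qed.

Lemma transvectionE v s y : transvection v s *m y = y + (s * form v y) *: v.
Proof.
rewrite /transvection mulmxDl mul1mx -scalemxAl -mulmxA mul_form.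
by rewrite mul_mx_scalar scalerA.
Qed.

Lemma form_alt_mx v n (N : 'rV[F]_n) : v^T *m J *m (v *m N) = 0.
Proof. by rewrite mulmxA mul_form form_alt raddf0 mul0mx. Qed.

Lemma transvection_isometry v s : isometry (transvection v s).
Proof.
rewrite /isometry /transvection [_^T]linearD [X in _ + X]linearZ /=.
rewrite !trmx_mul trmx1 trmxK JT.
have -> : (1%:M + s *: (- J *m v *m v^T)) *m J
    = J - s *: (J *m v *m (v^T *m J)).
  by rewrite mulmxDl mul1mx -scalemxAl !mulNmx scalerN !mulmxA.
rewrite mulmxDr mulmx1 -scalemxAr mulmxBl -scalemxAl.
rewrite -[_ *m _ *m (v *m _)]mulmxA form_alt_mx mulmx0 scaler0 subr0.
by rewrite [J *m (v *m _)]mulmxA subrK.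
Qed.

Lemma transvectionD v s t :
  transvection v s *m transvection v t = transvection v (s + t).
Proof.
rewrite [X in X *m _]/transvection mulmxDl mul1mx -scalemxAl.
have -> : v *m (v^T *m J) *m transvection v t = v *m (v^T *m J).
  rewrite /transvection mulmxDr mulmx1 -scalemxAr.
  by rewrite -[_ *m _ *m (v *m _)]mulmxA form_alt_mx mulmx0 scaler0 addr0.
by rewrite /transvection scalerDl -addrA [t *: _ + _]addrC.
Qed.

Lemma transvection0 v : transvection v 0 = 1%:M.
Proof. by rewrite /transvection scale0r addr0. Qed.

Lemma transvectionZ v s t :
  transvection (s *: v) t = transvection v (s ^+ 2 * t).
Proof.
rewrite /transvection linearZ /= -!scalemxAl -scalemxAr !scalerA.
by congr (1%:M + _); congr (_ *: _); ring.
Qed.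

Lemma transvection_conj M v s :
  isometry M -> M *m transvection v s = transvection (M *m v) s *m M.
Proof.
move=> isoM; rewrite /transvection mulmxDr mulmxDl mulmx1 mul1mx.
rewrite -scalemxAr -scalemxAl trmx_mul; congr (_ + _ *: _).
rewrite -[in RHS]mulmxA -[v^T *m _ *m J]mulmxA -[v^T *m _ *m M]mulmxA.
by rewrite isoM !mulmxA.
Qed.

Lemma isometryM M N : isometry M -> isometry N -> isometry (M *m N).
Proof.
rewrite /isometry trmx_mul => isoM isoN.
by rewrite -[RHS]isoN -[in RHS]isoM !mulmxA.
Qed.

Lemma isometry_form M x y : isometry M -> form (M *m x) (M *m y) = form x y.
Proof.
by move=> isoM; rewrite /form trmx_mul -[in RHS]isoM !mulmxA.
Qed.

(** The transvection along [M x - x] that sends [M x] back to [x] exists when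
    [x] and [M x] are not orthogonal. Every vector fixed by [M] is orthogonal
    to [M x - x], so it stays fixed, and [x] becomes fixed as well. *)
Lemma transvection_fix_more M x : isometry M -> form x (M *m x) != 0 ->
  exists v s, (\rank (transvection v s *m M - 1%:M)%R < \rank (M - 1%:M)%R)%N.
Proof.
move=> isoM cN0; set c := form x (M *m x) in cN0.
pose v := M *m x - x; exists v, c^-1.
set T := transvection _ _.
have vMx : form v (M *m x) = - c.
  by rewrite formDl formNl form_alt add0r.
have Tx : T *m (M *m x) = x.
  rewrite transvectionE vMx mulrN mulVf // scaleN1r /v opprB.
  by rewrite addrCA subrr addr0.
have Tfix y : M *m y = y -> T *m y = y.
  move=> My; have vy : form v y = 0.
    by rewrite formDl formNl -[in X in X - _]My isometry_form // subrr.
  by rewrite transvectionE vy mulr0 scale0r addr0.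
have kerE N (y : 'cV[F]_d) : (y^T <= kermx (N - 1%:M)^T)%MS = (N *m y == y).
  apply/sub_kermxP/eqP => [|Ny].
    move/(congr1 trmx); rewrite -trmx_mul trmxK trmx0 mulmxBl mul1mx => /eqP.
    by rewrite subr_eq0 => /eqP.
  by rewrite -trmx_mul mulmxBl mul1mx Ny subrr trmx0.
rewrite -[X in (X < _)%N]mxrank_tr -[X in (_ < X)%N]mxrank_tr.
have : (kermx (M - 1%:M)^T < kermx (T *m M - 1%:M)^T)%MS.
  rewrite ltmxE; apply/andP; split.
    apply/row_subP => i; rewrite -[row i _]trmxK kerE -mulmxA.
    have : ((row i (kermx (M - 1%:M)^T))^T^T <= kermx (M - 1%:M)^T)%MS.
      by rewrite trmxK row_sub.
    by rewrite kerE => /eqP My; rewrite My Tfix.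
  apply/negP => kTk; have : (x^T <= kermx (M - 1%:M)^T)%MS.
    by apply: submx_trans kTk; rewrite kerE -mulmxA Tx.
  by rewrite kerE => /eqP Mx; move: cN0; rewrite /c Mx form_alt eqxx.
by move/rank_ltmx; rewrite !mxrank_ker ltn_sub2lE ?rank_leq_row.
Qed.

(** Induction on the rank of [M - 1], lowered by [transvection_fix_more]. When
    [x] is orthogonal to [M x] for all [x], one first composes with a
    transvection along some [M x0 - x0]: this does not increase the rank, and
    it destroys the orthogonality. *)
Theorem isometry_transvection_ind (Q : 'M[F]_d -> Prop) : J \in unitmx ->
  Q 1%:M -> (forall v s M, Q M -> Q (transvection v s *m M)) ->
  forall M, isometry M -> Q M.
Proof.
move=> uJ Q1 QT.
have QK v s M : Q (transvection v s *m M) -> Q M.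
  move=> /(QT v (- s)); rewrite mulmxA transvectionD addNr transvection0.
  by rewrite mul1mx.
move=> M; have [k] := ubnP (\rank (M - 1%:M)).
elim: k => // k IHk in M *; rewrite ltnS => rM isoM.
have step N x : (\rank (N - 1%:M)%R <= k)%N -> isometry N ->
    form x (N *m x) != 0 -> Q N.
  move=> rN isoN /(transvection_fix_more isoN)[v [s lt_r]].
  apply: (QK v s); apply: IHk; first exact: leq_trans lt_r rN.
  by apply: isometryM => //; exact: transvection_isometry.
have [[x xMx]|alt0] := pselect (exists x, form x (M *m x) != 0).
  exact: step xMx.
have {}alt0 x : form x (M *m x) = 0.
  by apply/eqP; apply: contra_notT alt0 => xN0; exists x.
have [/eqP|DN0] := eqVneq (M - 1%:M) 0; first by rewrite subr_eq0 => /eqP ->.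
have [x0 wN0] : exists x0, M *m x0 - x0 != 0.
  have /matrix0Pn[i [j Nij]] := DN0.
  exists (delta_mx j 0); rewrite -{2}[delta_mx j 0]mul1mx -mulmxBl -colE.
  by apply: contraNneq Nij => /colP/(_ i); rewrite !mxE => ->.
pose w := M *m x0 - x0.
have [x xw] := form_nondegenerate uJ wN0.
apply: (QK w 1); apply: (step _ x).
- apply: leq_trans rM; rewrite /transvection scale1r mulmxDl mul1mx.
  have -> : M + w *m (w^T *m J) *m M - 1%:M =
      (M - 1%:M) *m (1%:M + x0 *m (w^T *m J *m M)).
    rewrite mulmxDr mulmx1 addrAC; congr (_ + _).
    by rewrite [RHS]mulmxA [(_ - _) *m x0]mulmxBl mul1mx -/w !mulmxA.
  exact: mxrankM_maxl.
- by apply: isometryM => //; exact: transvection_isometry.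
rewrite -mulmxA transvectionE mul1r formDr alt0 add0r formZr.
(* Polarising [form x (M x) = 0] gives [form x (M x0) = - form x0 (M x)]. *)
suff -> : form w (M *m x) = form x w by rewrite mulf_neq0.
have xMx0 : form x (M *m x0) = - form x0 (M *m x).
  apply/eqP; rewrite -addr_eq0; have := alt0 (x + x0).
  by rewrite mulmxDr !(formDl, formDr) !alt0 add0r addr0 => ->.
rewrite /w formDl formDr formNl formNr isometry_form // xMx0.
by rewrite (formC x0 x) opprK addrC.
Qed.

End Transvections.
(** * Zariski density from a chain of transvections *)
Section ZariskiDensity.
Variables (F : numFieldType) (d : nat) (J : 'M[F]_d).
Hypotheses (JT : J^T = - J) (J_unit : J \in unitmx).
Variable S : 'M[F]_d -> Prop.
Hypotheses (S1 : S 1%:M) (SM : forall M N, S M -> S N -> S (M *m N)).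

Local Notation Z := (zariski_closure S).
Local Notation T := (transvection J).
Local Notation form := (form J).
Implicit Types (u v w x : 'cV[F]_d).

(** For [v] nonzero: the root subgroup of [v] lies in the closure. *)
Definition transvections_in_closure v := forall s, Z (T v s).
Local Notation L := transvections_in_closure.

Let ZM M N : Z M -> Z N -> Z (M *m N).
Proof. exact: zariski_closure_mul. Qed.

Let subZ M : S M -> Z M.
Proof. by move=> SX f _; apply. Qed.

Let natr_inj : injective (fun k : nat => k%:R : F).
Proof. by move=> i j /eqP; rewrite eqr_nat => /eqP. Qed.

Lemma root_of_power v (s : F) : s != 0 -> S (T v s) -> L v.
Proof.
move=> sN0 ST t.
have Sk k : S (T v (k%:R * s)).
  elim: k => [|k IHk]; first by rewrite mul0r transvection0.
  by rewrite -natr1 mulrDl mul1r -transvectionD //; exact: SM.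
have inj_u : injective (fun k : nat => k%:R * s).
  by move=> i j /(mulIf sN0) /natr_inj.
have := @zariski_closure_curve F d S 1%:M (v *m (v^T *m J)) 0 _ inj_u.
move=> /(_ _ t); rewrite scaler0 addr0; apply => k.
by rewrite scaler0 addr0; exact/subZ/Sk.
Qed.

Lemma root_scale v (a : F) : L v -> L (a *: v).
Proof. by move=> Lv s; rewrite transvectionZ. Qed.

(** The transvection along [v] with parameter [t] maps [u] to [u + a v] for a
    suitable [t], and conjugation by an isometry carries transvections along
    [u] to transvections along the image of [u]. *)
Lemma root_add u v (a : F) : L u -> L v -> form u v != 0 -> L (u + a *: v).
Proof.
move=> Lu Lv uvN0 s; pose t := - (a / form u v).
have -> : T (u + a *: v) s = T v t *m T u s *m T v (- t).
  rewrite (transvection_conj _ _ (transvection_isometry JT v t)) -mulmxA.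
  rewrite transvectionD // subrr transvection0 mulmx1 transvectionE.
  by rewrite (formC JT u v) mulrNN mulfVK.
by do 2?apply: ZM.
Qed.

(** The transvection along [u + a w] is quadratic in [a], so [a = 0] follows
    from infinitely many other values. *)
Lemma root_limit u w : (forall k : nat, L (u + k.+1%:R *: w)) -> L u.
Proof.
move=> Luw s.
pose B := s *: (u *m (w^T *m J) + w *m (u^T *m J)).
pose C := s *: (w *m (w^T *m J)).
have TE a : T (u + a *: w) s = T u s + a *: B + a ^+ 2 *: C.
  rewrite /T /B /C linearD linearZ /= !mulmxDl mulmxDr -!scalemxAl mulmxDr.
  rewrite -!scalemxAr.
  move: (u *m (u^T *m _)) (u *m (w^T *m _)) (w *m (u^T *m _)) (w *m (w^T *m _)).
  by move=> X1 X2 X3 X4; apply/matrixP => i j; rewrite !mxE; ring.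
have inj_u : injective (fun k : nat => k.+1%:R : F).
  by move=> i j /natr_inj [].
have := @zariski_closure_curve F d S (T u s) B C _ inj_u.
move=> /(_ _ 0); rewrite scale0r expr0n scale0r !addr0; apply => k.
by rewrite -TE; exact: Luw.
Qed.

Variables (n : nat) (v : nat -> 'cV[F]_d).
Hypotheses (v_root : forall k, (k < n)%N -> L (v k))
  (v_chain : forall k, (k.+1 < n)%N -> form (v k) (v k.+1) != 0)
  (v_far : forall j k, (j < k)%N -> (k.+1 < n)%N -> form (v j) (v k.+1) = 0).

(** Only the last vector [v k] pairs non-trivially with the new one [v k.+1].
    Hence [root_add] applies to combinations whose coefficient on [v k] is not
    zero, and the others are limits of these.  The [v i] need not be linearly
    independent, so the argument is on coefficients, not on vectors. *)
Lemma root_span k (a : nat -> F) : (k <= n)%N -> L (\sum_(i < k) a i *: v i).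
Proof.
case: k => [_|k].
  rewrite big_ord0 => s; apply: subZ.
  by rewrite /transvection mul0mx scaler0 addr0.
elim: k a => [|k IHk] a kn.
  by rewrite big_ord1; apply/root_scale/v_root.
rewrite big_ord_recr /=.
have formE (c : nat -> F) : form (\sum_(i < k.+1) c i *: v i) (v k.+1)
    = c k * form (v k) (v k.+1).
  rewrite big_ord_recr /= formDl formZl.
  rewrite (big_morph (fun x => form x (v k.+1)) (fun x y => formDl J x y _)
    (_ : form 0 _ = 0)); last by rewrite -(scale0r 0) formZl mul0r.
  by rewrite big1 ?add0r // => i _; rewrite formZl v_far ?mulr0.
have generic (c : nat -> F) b : c k != 0 ->
    L (\sum_(i < k.+1) c i *: v i + b *: v k.+1).
  move=> ckN0; apply: root_add; first exact: IHk (ltnW kn).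
    exact: v_root.
  by rewrite formE mulf_neq0 ?v_chain.
have [ak0|akN0] := eqVneq (a k) 0; last exact: generic.
apply: (@root_limit _ (v k)) => m.
pose c i := if i == k then m.+1%:R else a i.
have -> : \sum_(i < k.+1) a i *: v i + a k.+1 *: v k.+1 + m.+1%:R *: v k
    = \sum_(i < k.+1) c i *: v i + a k.+1 *: v k.+1.
  rewrite addrAC; congr (_ + _); rewrite !big_ord_recr /= ak0 scale0r addr0.
  rewrite {2}/c eqxx; congr (_ + _); apply: eq_bigr => i _.
  by rewrite /c ltn_eqF.
by apply: generic; rewrite /c eqxx pnatr_eq0.
Qed.

Theorem isometry_zariski_closure M :
  (forall x, exists a : nat -> F, x = \sum_(i < n) a i *: v i) ->
  isometry J M -> Z M.
Proof.
move=> v_span; apply: (isometry_transvection_ind JT) => //; first exact: subZ.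
move=> x s N ZN; apply: ZM => //; have [a ->] := v_span x.
exact: root_span.
Qed.

End ZariskiDensity.
(** * The mass of a set under the walk *)
Section WalkMass.
Variables (R : realType) (G : groupType) (mu : G -> R).

(** The probability that the walk is in [p] at time [k], by conditioning on the
    factor that multiplies from the left. The sequence [s] enumerates the
    support of [mu]; working with it turns sums over the group into finite
    ones. *)
Fixpoint walk_mass (s : seq G) (k : nat) (p : pred G) : R :=
  if k is k'.+1
  then \sum_(x <- s) mu x * walk_mass s k' (fun h => p (x * h)%g)
  else (p 1%g)%:R.

Lemma convolution_mass (s : seq G) (nu : G -> R) (p : pred G) :
  uniq s -> supp mu = [set` s] -> finite_set (supp nu) ->
  \sum_(g \in [set` p]) convolution mu nu g
  = \sum_(x <- s) mu x * \sum_(h \in [set h | p (x * h)%g]) nu h.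
Proof.
move=> s_uniq sE fnu.
have mu0 x : x \notin s -> mu x = 0.
  move=> xs; apply/eqP; apply: contraNT xs => muxN0.
  by have : supp mu x by []; rewrite sE.
have convE g : convolution mu nu g = \sum_(x <- s) mu x * nu (x^-1 * g)%g.
  rewrite /convolution (reindex_fsbigT (fun x => x^-1 * g)%g); last first.
    exists (fun h => g * h^-1)%g => x.
      by rewrite invgM invgK mulgA mulgV mul1g.
    by rewrite invgM invgK -mulgA mulVg mulg1.
  rewrite [RHS](bigfs _ (P := predT)) // => [|x _ /mu0 mux].
    have -> : [set` predT] = [set: G] by apply/seteqP; split.
    by apply: eq_fsbigr => x _; rewrite invgM invgK mulgA mulgV mul1g.
  by rewrite mux mul0r.
have /finite_seqP[t0 t0E] :
    finite_set [set (x * y)%g | x in supp mu & y in supp nu].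
  by apply: finite_image2 => //; rewrite sE; exact: finite_seq.
have t_uniq := undup_uniq t0.
have nu0 x g : x \in s -> g \notin undup t0 -> nu (x^-1 * g)%g = 0.
  move=> xs; rewrite mem_undup => gt; apply/eqP; apply: contraNT gt => nuN0.
  have : [set` t0] g; last by [].
  rewrite -t0E; exists x; first by rewrite sE.
  by exists (x^-1 * g)%g => //; rewrite mulgA mulgV mul1g.
under eq_fsbigr do rewrite convE.
rewrite -(bigfs _ t_uniq) => [|g _ gt]; last first.
  by rewrite big_seq big1 // => x xs; rewrite nu0 ?mulr0.
rewrite exchange_big /= big_seq [RHS]big_seq; apply: eq_bigr => x xs.
rewrite -mulr_sumr (bigfs _ t_uniq) => [|g _ /nu0 -> //].
congr (_ * _).
have bij : set_bij [set h | p (x * h)%g] [set` p] (fun h => x * h)%g.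
  split=> [h //|a b _ _ /mulgI //|g pg].
  by exists (x^-1 * g)%g; rewrite /= mulgA mulgV mul1g.
rewrite (reindex_fsbig _ _ _ _ bij).
by apply: eq_fsbigr => h _; rewrite mulgA mulVg mul1g.
Qed.

Lemma walk_massE (s : seq G) k (p : pred G) :
  uniq s -> supp mu = [set` s] ->
  \sum_(g \in [set` p]) convolution_pow mu k g = walk_mass s k p.
Proof.
move=> s_uniq sE; elim: k p => [|k IHk] p /=.
  rewrite /convolution_pow /= -(bigfs _ (r := [:: 1%g])) //= => [|g _];
    last by rewrite inE => /negbTE ->.
  by rewrite big_cons big_nil eqxx addr0; case: (p _).
rewrite /convolution_pow /= -/(convolution_pow mu k).
rewrite (convolution_mass _ s_uniq sE).
  by apply: eq_bigr => x _; rewrite -IHk.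
by apply: convolution_pow_supp; rewrite sE; exact: finite_seq.
Qed.

Variable s : seq G.
Hypotheses (mu_ge0 : forall g, 0 <= mu g) (mu_sum1 : \sum_(x <- s) mu x = 1).
Local Notation mass := (walk_mass s).

Lemma eq_walk_mass k (p q : pred G) : p =1 q -> mass k p = mass k q.
Proof. by move=> /funext ->. Qed.

Lemma walk_mass_le k (p q : pred G) : subpred p q -> mass k p <= mass k q.
Proof.
elim: k p q => [|k IHk] p q pq /=.
  by rewrite ler_nat; case: (p _) (pq 1%g) => // ->.
apply: ler_sum => x _; rewrite ler_wpM2l //; apply: IHk => h; exact: pq.
Qed.

Lemma walk_mass_pred0 k (p : pred G) : p =1 xpred0 -> mass k p = 0.
Proof.
elim: k p => [|k IHk] p p0 /=; first by rewrite p0.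
by rewrite big1 // => x _; rewrite IHk ?mulr0 // => h; rewrite p0.
Qed.

Lemma walk_mass_ge0 k p : 0 <= mass k p.
Proof. by rewrite -(@walk_mass_pred0 k xpred0) // walk_mass_le. Qed.

Lemma walk_mass_le1 k p : mass k p <= 1.
Proof.
elim: k p => [|k IHk] p /=; first by case: (p _).
by rewrite -mu_sum1 ler_sum // => x _; rewrite ler_piMr.
Qed.

(** Events that hardly overlap cannot all be likely. At a point lying in [N] of
    the sets the inequality reads [N <= 1 + (N ^ 2 - N)], that is [0 <= (N - 1)
    ^ 2]. *)
Lemma walk_mass_overlap k (n : nat) (p : 'I_n -> pred G) :
  \sum_i mass k (p i)
  <= 1 + \sum_i \sum_(j | j != i) mass k (predI (p i) (p j)).
Proof.
elim: k p => [|k IHk] p /=.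
  set b := fun i => p i 1%g.
  have -> : \sum_i \sum_(j | j != i) (b i && b j)%:R =
      (\sum_i (b i)%:R) ^+ 2 - \sum_i (b i)%:R :> R.
    rewrite expr2 mulr_suml -sumrB; apply: eq_bigr => i _.
    rewrite mulr_sumr [in RHS](bigD1 i) //= -natrM mulnb andbb addrC addrK.
    by apply: eq_bigr => j _; rewrite -natrM mulnb.
  set N := \sum_i _; have := sqr_ge0 (N - 1); nra.
rewrite exchange_big /=.
have -> : \sum_i \sum_(j | j != i)
    \sum_(x <- s) mu x * mass k (fun h => p i (x * h)%g && p j (x * h)%g)
  = \sum_(x <- s) mu x * \sum_i \sum_(j | j != i)
      mass k (fun h => p i (x * h)%g && p j (x * h)%g).
  under eq_bigr do rewrite exchange_big /=.
  rewrite exchange_big /=; apply: eq_bigr => x _.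
  by rewrite mulr_sumr; apply: eq_bigr => i _; rewrite mulr_sumr.
rewrite -{1}mu_sum1 -big_split /=; apply: ler_sum => x _.
rewrite -mulr_sumr -{2}[mu x]mulr1 -mulrDr ler_wpM2l //.
Qed.

End WalkMass.
(** * Products of a given number of elements of the support *)

(** The positions that the walk can take at time [k]. *)
Inductive reach (G : groupType) (s : seq G) : nat -> G -> Prop :=
| reach0 : reach s 0 1%g
| reachS x k g : x \in s -> reach s k g -> reach s k.+1 (x * g)%g.

Section Reach.
Variables (G : groupType) (s : seq G).

Lemma reachM k l g h : reach s k g -> reach s l h -> reach s (k + l) (g * h)%g.
Proof.
elim=> {k g} [|x k g xs _ IH] rh; first by rewrite mul1g.
by rewrite addSn -mulgA; apply: reachS (IH rh).
Qed.

Lemma reachX k g t : reach s k g -> reach s (k * t) (g ^+ t)%g.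
Proof.
move=> rg; elim: t => [|t IHt]; first by rewrite muln0; exact: reach0.
by rewrite mulnS expgS; exact: reachM.
Qed.

Lemma reach_nondegenerate (R : realType) (mu : G -> R) :
  supp mu = [set` s] -> nondegenerate_measure mu ->
  forall g, exists2 k, (0 < k)%N & reach s k g.
Proof.
move=> sE nondeg g.
suff : smallest [set A : set G | forall x y, A x -> A y -> A (x * y)%g]
    (supp mu) `<=` [set g | exists2 k, (0 < k)%N & reach s k g].
  by apply; rewrite (nondeg : smallest _ _ = _).
apply: smallest_sub => [x y [k k0 rx] [l l0 ry]|x].
  by exists (k + l)%N; [rewrite addn_gt0 k0|exact: reachM].
rewrite sE => xs; exists 1%N => //.
by rewrite -[x]mulg1; apply: reachS xs (reach0 s).
Qed.

(** The elements [e ^ (q t)] are products of different numbers of elements of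
    [s], but all these numbers are multiples of [q], and the identity is a
    product of [q] elements; padding with it makes the lengths equal. The walk
    may be periodic, hence the exponent [q]. *)
Lemma reach_common_length (E : seq G) (N : nat) :
  (forall g, exists2 k, (0 < k)%N & reach s k g) ->
  exists q r, (0 < q)%N /\
    forall e t, e \in E -> (t <= N)%N -> reach s r (e ^+ (q * t))%g.
Proof.
move=> reach_all; have [q q0 rq] := reach_all 1%g.
have /choice[a ra] : forall g, exists k, reach s k g.
  by move=> g; have [k _ rk] := reach_all g; exists k.
exists q, (q * (\sum_(e <- E) a e * N))%N; split=> // e t eE tN.
have le_t : (a e * t <= \sum_(e <- E) a e * N)%N.
  by rewrite (big_rem e) //= (leq_trans (leq_mul (leqnn _) tN)) // leq_addr.
rewrite -(subnKC le_t) mulnDr -[(e ^+ _)%g]mulg1; apply: reachM.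
  by rewrite mulnCA; exact: reachX.
by rewrite -(expg1n _ (\sum_(e <- E) a e * N - a e * t)); exact: reachX.
Qed.

End Reach.

(** * The walk does not concentrate on subspaces *)
Section SubspaceMass.
Variables (R : realType) (G : groupType) (mu : G -> R) (s : seq G).
Hypotheses (mu_ge0 : forall g, 0 <= mu g) (mu_sum1 : \sum_(x <- s) mu x = 1).
Hypothesis mu_gt0 : forall x, x \in s -> 0 < mu x.
Hypothesis reach_all : forall g, exists2 k, (0 < k)%N & reach s k g.

Variables (F : fieldType) (m : nat) (phi : G -> 'rV[F]_m) (A : G -> 'M[F]_m).
Hypotheses (A1 : A 1%g = 1%:M) (AM : forall x y, A (x * y)%g = A y *m A x)
  (phiM : forall x h, phi (x * h)%g = phi h *m A x).
Implicit Types (U V : 'M[F]_m) (d k : nat).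

Definition inside U : pred G := fun g => (phi g <= U)%MS.
(** The subspace of the [v] with [v *m A x] in [U]. *)
Definition translate U x : 'M[F]_m := U *m A x^-1%g.
Definition contains_orbit U := forall g, inside U g.
Local Notation mass k U := (walk_mass mu s k (inside U)).

Lemma mul_AV x : A x *m A x^-1%g = 1%:M.
Proof. by rewrite -AM mulVg. Qed.

Lemma mul_VA x : A x^-1%g *m A x = 1%:M.
Proof. by rewrite -AM mulgV. Qed.

Lemma inside_translate U x h : inside (translate U x) h = inside U (x * h)%g.
Proof.
rewrite /inside /translate phiM; apply/idP/idP => /submxMr.
  by move/(_ _ (A x)); rewrite -mulmxA mul_VA mulmx1.
by move/(_ _ (A x^-1%g)); rewrite -mulmxA mul_AV mulmx1.
Qed.

Lemma translateM U x y : translate (translate U x) y = translate U (x * y)%g.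
Proof. by rewrite /translate invgM AM mulmxA. Qed.

Lemma translate1 U : translate U 1%g = U.
Proof. by rewrite /translate invg1 A1 mulmx1. Qed.

Lemma rank_translate U x : (\rank (translate U x) <= \rank U)%N.
Proof. exact: mxrankM_maxl. Qed.

Lemma contains_orbit_translate U x :
  contains_orbit (translate U x) -> contains_orbit U.
Proof.
move=> cU g; have := cU (x^-1 * g)%g.
by rewrite inside_translate mulgA mulgV mul1g.
Qed.

Lemma mass_step k U :
  mass k.+1 U = \sum_(x <- s) mu x * mass k (translate U x).
Proof.
apply: eq_bigr => x _; congr (_ * _); apply: eq_walk_mass => h.
by rewrite inside_translate.
Qed.

(** Subspaces containing the whole orbit have mass 1; the family of the others
    is stable under translation and under passing to smaller subspaces. *)
Let fam d U := ~ contains_orbit U /\ (\rank U < d)%N.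

Let fam_translate d U x : fam d U -> fam d (translate U x).
Proof.
case=> cU rU; split; first by move=> /contains_orbit_translate.
exact: leq_ltn_trans (rank_translate U x) rU.
Qed.

Lemma mass_bound_later d k (B : R) : (forall U, fam d U -> mass k U <= B) ->
  forall j U, fam d U -> mass (k + j) U <= B.
Proof.
move=> kB; elim=> [|j IHj] U fU; first by rewrite addn0 kB.
rewrite addnS mass_step -[B]mul1r -mu_sum1 mulr_suml; apply: ler_sum => x _.
by rewrite ler_wpM2l // IHj //; exact: fam_translate.
Qed.

(** If [B] bounds all masses at time [k], the deficit of [U] at time [k + r] is
    an average of deficits, all nonnegative, of its translates at time [k];
    each translate has weight at least [p ^ r] in it. *)
Lemma heavy_translate d k (B p : R) : (forall U, fam d U -> mass k U <= B) ->
  0 < p -> (forall x, x \in s -> p <= mu x) ->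
  forall r g, reach s r g -> forall U, fam d U ->
  p ^+ r * (B - mass k (translate U g)) <= B - mass (k + r) U.
Proof.
move=> kB p0 pmu r g; elim=> {r g} [|x r g xs _ IH] U fU.
  by rewrite expr0 mul1r addn0 translate1.
have gap_ge0 y : 0 <= B - mass (k + r) (translate U y).
  by rewrite subr_ge0 (mass_bound_later kB) //; exact: fam_translate.
have -> : B - mass (k + r.+1) U =
    \sum_(y <- s) mu y * (B - mass (k + r) (translate U y)).
  rewrite addnS mass_step -{1}[B]mul1r -mu_sum1 mulr_suml -sumrB.
  by apply: eq_bigr => y _; rewrite mulrBr.
rewrite (big_rem x) //= -translateM exprS -mulrA.
apply: (@le_trans _ _ (mu x * (B - mass (k + r) (translate U x)))).
  apply: ler_pM; rewrite ?(ltW p0) ?pmu //; last exact/IH/fam_translate.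
  rewrite mulr_ge0 ?exprn_ge0 ?(ltW p0) // subr_ge0 kB //.
  by do 2 apply: fam_translate.
by rewrite lerDl sumr_ge0 // => y _; rewrite mulr_ge0.
Qed.

Lemma mu_lower_bound :
  exists p : R, [/\ 0 < p, p <= 1 & forall x, x \in s -> p <= mu x].
Proof.
elim: s mu_gt0 => [|x s' IH] gt0; first by exists 1.
have [|p [p0 p1 ps]] := IH.
  by move=> y ys; apply: gt0; rewrite inE ys orbT.
exists (Num.min p (mu x)); split.
- by rewrite lt_min p0 gt0 ?mem_head.
- by rewrite ge_min p1.
- by move=> y; rewrite inE ge_min => /orP[/eqP ->|/ps ->//]; rewrite lexx orbT.
Qed.

Variable E : seq G.
(** For a polynomial representation this is Zariski density of the submonoids
    that contain a power of each element of [E]. *)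
Hypothesis stable_contains_orbit : forall U g0, inside U g0 ->
  (forall e, e \in E -> exists2 N, (0 < N)%N & (U *m A (e ^+ N)%g <= U)%MS) ->
  contains_orbit U.

Let negligible d := forall eps : R, 0 < eps ->
  exists K, forall k, (K <= k)%N -> forall U, fam d U -> mass k U <= eps.

Lemma rank_cap_lt d U V :
  (\rank U <= d)%N -> ~~ (U <= V)%MS -> (\rank (U :&: V)%MS < d)%N.
Proof.
move=> rU UV; rewrite ltnNge; apply: contra UV => le_d.
have [le_r eq_r] := mxrank_leqif_sup (capmxSl U V).
apply: submx_trans (capmxSr U V); rewrite -eq_r eqn_leq le_r.
exact: leq_trans rU le_d.
Qed.

(** If no [V i] were contained in a later [V j], the intersections would have
    smaller rank, hence small mass, and [walk_mass_overlap] would give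
    [3 <= 1 + N ^ 2 / N ^ 2]. *)
Lemma heavy_translates_collide d k (c : R) (N : nat) (V : 'I_N -> 'M[F]_m) :
  (forall U, fam d U -> mass k U <= N%:R ^- 2) ->
  3 <= N%:R * c ->
  (forall i, fam d.+1 (V i)) -> (forall i, c <= mass k (V i)) ->
  exists i j : 'I_N, (i < j)%N /\ (V i <= V j)%MS.
Proof.
move=> small Nc famV heavy; apply: contrapT => nocol.
have cap_small i j : j != i -> mass k (V i :&: V j)%MS <= N%:R ^- 2.
  wlog lt_ij : i j / (i < j)%N => [hw ji|_].
    have [/hw|le_ji] := ltnP i j; first exact.
    rewrite (@eq_walk_mass _ _ _ _ _ _ (inside (V j :&: V i)%MS)).
      by apply: hw; rewrite 1?eq_sym // ltn_neqAle ji.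
    by move=> h; rewrite /inside !sub_capmx andbC.
  apply: small; split.
    move=> cV; case: (famV i) => + _; apply => g.
    by apply: submx_trans (cV g) (capmxSl _ _).
  apply: rank_cap_lt; first by case: (famV i).
  by apply/negP => Vij; apply: nocol; exists i, j.
have : 3 <= \sum_i mass k (V i).
  apply: le_trans Nc _; rewrite -[X in X%:R * _]card_ord mulr_natl -sumr_const.
  exact: ler_sum.
have Npos : 0 < N%:R :> R.
  by rewrite ltr0n lt0n; apply: contraTneq Nc => ->; rewrite mul0r -ltNge.
apply/negP; rewrite -ltNge.
apply: le_lt_trans (walk_mass_overlap mu_ge0 mu_sum1 _ _) _.
apply: (@le_lt_trans _ _ (1 + 1)); last by rewrite -natr1 -natr1; lra.
rewrite lerD2l; apply: (@le_trans _ _ (\sum_(i < N) \sum_(j < N) N%:R ^- 2)).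
  apply: ler_sum => i _; rewrite [leRHS](bigID (fun j => j != i)) /=.
  rewrite ler_wpDr //.
    by apply: sumr_ge0 => j _; rewrite invr_ge0 exprn_ge0 // ltW.
  apply: ler_sum => j ji; apply: le_trans (cap_small i j ji).
  apply: walk_mass_le => // h /andP[hi hj].
  by rewrite /inside sub_capmx; apply/andP.
rewrite !sumr_const card_ord -mulrnA -[_ *+ _]mulr_natl natrM -expr2 divff //.
by rewrite expf_neq0 // gt_eqF.
Qed.

(** The supremum [c] of the levels that are attained at all times is positive
    if the claim fails. At a late time [k] all masses are at most [c + delta],
    while some [U] has mass more than [c - delta] at time [k + r]. The choice
    of [delta] makes the translates of [U] by products of [r] elements have
    mass at least [c / 2] at time [k]. *)
Lemma negligibleS d : negligible d -> negligible d.+1.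
Proof.
move=> negd eps eps0; apply: contrapT => not_small.
pose C := [set c : R | forall k, exists2 U, fam d.+1 U & c <= mass k U].
have Ceps : C eps.
  move=> k; apply: contrapT => nU; apply: not_small; exists k => j kj U fU.
  rewrite -(subnKC kj); apply: (@mass_bound_later d.+1) => // V fV.
  by apply: ltW; rewrite ltNge; apply/negP => le_eps; apply: nU; exists V.
have supC : has_sup C.
  split; first by exists eps.
  by exists 1 => c /(_ 0%N)[U _] /le_trans; apply; exact: walk_mass_le1.
set c := sup C.
have c0 : 0 < c by apply: lt_le_trans eps0 (ub_le_sup supC.2 Ceps).
have [p [p0 p1 pmu]] := mu_lower_bound.
have [N Nc] : exists N : nat, 3 <= N%:R * (c / 2).
  exists (Num.truncn (3 / (c / 2))).+1; rewrite -ler_pdivrMr ?divr_gt0 //.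
  by apply/ltW/truncnS_gt.
have [q [r [q0 rE]]] := reach_common_length E N reach_all.
pose delta := p ^+ r * (c / 4).
have pr0 : 0 < p ^+ r by exact: exprn_gt0.
have pr1 : p ^+ r <= 1 by rewrite exprn_ile1 // ltW.
have delta0 : 0 < delta by rewrite mulr_gt0 // divr_gt0.
have delta_c : delta <= c / 4 by rewrite ler_piMl // divr_ge0 // ltW.
have [k0 k0B] : exists k0, forall U, fam d.+1 U -> mass k0 U <= c + delta.
  apply: contrapT => nk; have : C (c + delta).
    move=> k; apply: contrapT => nU; apply: nk; exists k => U fU.
    by apply: ltW; rewrite ltNge; apply/negP => ?; apply: nU; exists U.
  by move/(ub_le_sup supC.2); rewrite leNgt ltrDl delta0.
have [K Ksmall] : exists K, forall k, (K <= k)%N -> forall U, fam d U ->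
    mass k U <= N%:R ^- 2.
  apply: negd; rewrite invr_gt0 exprn_gt0 // ltr0n lt0n.
  by apply: contraTneq Nc => ->; rewrite mul0r -ltNge.
pose k := (k0 + K)%N.
have [c' Cc' lt_c'] := sup_adherent delta0 supC.
have [U fU heavyU] := Cc' (k + r)%N.
have heavy g : reach s r g -> c / 2 <= mass k (translate U g).
  move=> rg; have kB V : fam d.+1 V -> mass k V <= c + delta.
    exact: mass_bound_later.
  have := heavy_translate kB p0 pmu rg fU.
  move=> /le_trans/(_ (_ : _ <= p ^+ r * (c / 2))); rewrite ler_pM2l // => le_c.
  have : c + delta - mass k (translate U g) <= c / 2.
    apply: le_c; rewrite (_ : p ^+ r * (c / 2) = delta + delta); last first.
      by rewrite /delta; field.
    by rewrite -/c in lt_c'; lra.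
  by lra.
case: (fU) => nU _; apply: nU.
have [g0 Ug0] : exists g0, inside U g0.
  apply: contrapT => nin; have : mass (k + r) U = 0.
    by apply: walk_mass_pred0 => h; apply/negP => Uh; apply: nin; exists h.
  by rewrite -/c in lt_c'; lra.
apply: (stable_contains_orbit Ug0) => e eE.
pose V (i : 'I_N) := translate U (e ^+ (q * i))%g.
have [|i|i|i [j [lt_ij Vij]]] := @heavy_translates_collide d k (c / 2) N V _ Nc.
- by apply: Ksmall; exact: leq_addl.
- exact: fam_translate.
- by apply/heavy/rE => //; exact: ltnW.
(* Multiplying [V i <= V j] by [A (e ^ (q j))] gives the inclusion for the
   power [e ^ (q j - q i)]. *)
exists (q * j - q * i)%N; first by rewrite -mulnBr muln_gt0 q0 subn_gt0.
have := submxMr (A (e ^+ (q * j))%g) Vij.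
rewrite /V /translate -!mulmxA mul_VA mulmx1 -AM -expgnFr // leq_mul2l ltnW //.
by rewrite orbT.
Qed.

Theorem subspace_mass_to0 U : ~ contains_orbit U ->
  (fun k => mass k U) @ \oo --> (0 : R).
Proof.
move=> nU.
have neg d : negligible d.
  elim: d => [|d IHd]; last exact: negligibleS.
  by move=> eps _; exists 0%N => k _ V [].
apply/cvgrPdist_le => eps eps0.
have [K Ksmall] := neg (\rank U).+1 _ eps0.
near=> k; rewrite sub0r normrN ger0_norm ?walk_mass_ge0 //.
apply: Ksmall; last by split.
by near: k; exists K.
Unshelve. all: by end_near.
Qed.

End SubspaceMass.
(** * The image of the braid group *)
Section SymplecticImage.
Variables (n : nat) (b : symplectic_basis n).
Local Notation d := (n./2 + n./2)%N.
Local Notation toQ := (map_mx (intr : int -> rat)).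

Definition symp_mxQ : 'M[rat]_d := toQ (symp_mx n./2).
Definition rho (g : braid n.+1) : 'M[rat]_d := toQ (symplectic_rep b g).
(** The class of the k-th loop of the chain in H/K, in symplectic coordinates.
    It is indexed by [nat], with junk value 0, to make successors available. *)
Definition loop (k : nat) : 'cV[rat]_d :=
  if insub k is Some i then toQ (sb_coord b (basis_vec i)) else 0.
Local Notation J := symp_mxQ.
Local Notation isometryJ := (isometry J).

Lemma symp_mxT l : (symp_mx l)^T = - symp_mx l.
Proof.
rewrite /symp_mx tr_block_mx opp_block_mx !trmx0 !oppr0 opprK.
by rewrite raddfN /= !trmx1.
Qed.

Lemma symp_mxK l : symp_mx l *m - symp_mx l = 1%:M.
Proof.
rewrite mulmxN /symp_mx mulmx_block !(mul0mx, mulmx0, mul1mx, mulmx1).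
by rewrite !(add0r, addr0) opp_block_mx !opprK oppr0 -scalar_mx_block.
Qed.

Lemma symp_mxQT : J^T = - J.
Proof. by rewrite /J matrix.map_trmx symp_mxT map_mxN. Qed.

Lemma symp_mxQ_unit : J \in unitmx.
Proof.
have /mulmx1_unit[] // : J *m - J = 1%:M.
by rewrite /J -map_mxN -map_mxM symp_mxK map_mx1.
Qed.

Lemma Sp_isometry M : Sp n./2 M -> isometryJ (toQ M).
Proof.
by move=> MSp; rewrite /isometry /J matrix.map_trmx -!map_mxM (MSp : _ = _).
Qed.

Lemma rho_isometry g : isometryJ (rho g).
Proof. exact/Sp_isometry/symplectic_rep_Sp. Qed.

Lemma rho1 : rho 1%g = 1%:M.
Proof. by rewrite /rho symplectic_rep1 map_mx1. Qed.

Lemma rhoM g h : rho (g * h)%g = rho g *m rho h.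
Proof. by rewrite /rho symplectic_repM map_mxM. Qed.

Lemma sb_coordD_sum (I : finType) (c : I -> int) (x : I -> 'cV[int]_n) :
  sb_coord b (\sum_i c i *: x i) = \sum_i c i *: sb_coord b (x i).
Proof.
apply: sb_coord_uniq.
have -> : \sum_j (\sum_i c i *: sb_coord b (x i)) j 0 *: b j =
    \sum_i c i *: \sum_j sb_coord b (x i) j 0 *: b j.
  under eq_bigr do rewrite summxE scaler_suml.
  rewrite exchange_big /=; apply: eq_bigr => i _; rewrite scaler_sumr.
  by apply: eq_bigr => j _; rewrite mxE scalerA.
rewrite -sumrB; apply: in_kernel_sum => i; rewrite -scalerBr.
by apply: in_kernelZ; exact: sb_coordP.
Qed.

Lemma sb_coord_vec j : sb_coord b (b j) = delta_mx j 0.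
Proof.
apply: sb_coord_uniq; rewrite (bigD1 j) //= big1 => [|i ij].
  by rewrite mxE !eqxx scale1r addr0 subrr; exact: in_kernel0.
by rewrite mxE (negbTE ij) scale0r.
Qed.

Lemma iform_coord_l x y :
  iform x y = \sum_k sb_coord b x k 0 * iform (b k) y.
Proof.
rewrite (iform_kerl _ (sb_coordP b x)).
rewrite (big_morph (fun z => iform z y) (fun z t => iformDl z t y)
  (_ : iform 0 y = 0)); last by rewrite -(scale0r 0) iformZl mul0r.
by apply: eq_bigr => k _; rewrite iformZl.
Qed.

Lemma iform_coord_vec x j :
  iform x (b j) = ((sb_coord b x)^T *m symp_mx n./2) 0 j.
Proof.
rewrite iform_coord_l [RHS]mxE; apply: eq_bigr => k _.
by rewrite sb_symp [_^T 0 k]mxE.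
Qed.

Lemma iform_coord x y :
  iform x y = ((sb_coord b x)^T *m symp_mx n./2 *m sb_coord b y) 0 0.
Proof.
rewrite iformC iform_coord_l [RHS]mxE -sumrN; apply: eq_bigr => k _.
rewrite -mulrN -iformC iform_coord_vec. by rewrite mulrC.
Qed.

(** A Dehn twist is a transvection, also after passing to H/K. *)
Lemma rho_sigma (i : 'I_n) : rho (@sigma n.+1 i) = transvection J (loop i) 1.
Proof.
rewrite /loop valK /transvection scale1r /J matrix.map_trmx -!map_mxM.
rewrite -(map_mx1 intr) -map_mxD /rho; congr map_mx.
apply: symplectic_rep_uniq => j.
rewrite braid_act_sigma /dehn_twist iform_coord_vec.
set v := sb_coord b _; set c := (_ *m _) 0 j.
have -> : \sum_k (1%:M + v *m (v^T *m symp_mx n./2)) k j *: b k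
    = b j + c *: \sum_k v k 0 *: b k.
  have bj : \sum_k (k == j)%:R *: b k = b j.
    rewrite (bigD1 j) //= eqxx scale1r big1 ?addr0 // => k /negbTE ->.
    by rewrite scale0r.
  rewrite scaler_sumr -[X in _ = X + _]bj -big_split /=; apply: eq_bigr => k _.
  rewrite [(1%:M + _) k j]mxE [1%:M k j]mxE [(v *m _) k j]mxE big_ord1.
  by rewrite scalerDl scalerA mulrC.
rewrite opprD addrACA subrr add0r -scalerBr.
by apply: in_kernelZ; exact: sb_coordP.
Qed.

Lemma rho_sigmaX (i : 'I_n) N :
  rho (@sigma n.+1 i ^+ N)%g = transvection J (loop i) N%:R.
Proof.
elim: N => [|N IHN]; first by rewrite rho1 transvection0.
by rewrite expgSr rhoM IHN rho_sigma transvectionD ?natr1 //; exact: symp_mxQT.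
Qed.

Lemma form_loop (i j : 'I_n) :
  form J (loop i) (loop j) = (i.+1 == j)%:R - (j.+1 == i)%:R.
Proof.
rewrite /form /loop !valK /J matrix.map_trmx -!map_mxM mxE -iform_coord.
by rewrite iform_basis rmorphB /= !rmorph_nat.
Qed.

Lemma loop_span (x : 'cV[rat]_d) :
  exists a : nat -> rat, x = \sum_(i < n) a i *: loop i.
Proof.
exists (fun k => if insub k is Some i then \sum_j x j 0 * (b j i 0)%:~R else 0).
have dE j : delta_mx j 0 = \sum_(i < n) (b j i 0)%:~R *: loop i :> 'cV[rat]_d.
  rewrite -(map_delta_mx intr) -sb_coord_vec {1}[sb_vec b j]matrix_sum_delta.
  under eq_bigr do rewrite big_ord1.
  rewrite sb_coordD_sum map_mx_sum; apply: eq_bigr => i _.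
  by rewrite map_mxZ /loop valK.
rewrite {1}[x]matrix_sum_delta.
under eq_bigr do rewrite big_ord1 dE scaler_sumr.
rewrite exchange_big /=; apply: eq_bigr => i _; rewrite valK scaler_suml.
by apply: eq_bigr => j _; rewrite scalerA.
Qed.

Theorem rho_zariski_dense (H : braid n.+1 -> Prop) :
  H 1%g -> (forall g h, H g -> H h -> H (g * h)%g) ->
  (forall i : 'I_n, exists2 N, (0 < N)%N & H (@sigma n.+1 i ^+ N)%g) ->
  forall M, isometryJ M ->
  zariski_closure (fun X => exists2 h, H h & X = rho h) M.
Proof.
move=> H1 HM Hsigma M isoM.
have SM X Y : (exists2 h, H h & X = rho h) -> (exists2 h, H h & Y = rho h) ->
    exists2 h, H h & X *m Y = rho h.
  by move=> [g Hg ->] [h Hh ->]; exists (g * h)%g; [exact: HM|rewrite rhoM].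
have S1 : exists2 h, H h & 1%:M = rho h by exists 1%g; rewrite ?rho1.
apply: (isometry_zariski_closure symp_mxQT symp_mxQ_unit S1 SM (n := n)
  (v := loop) _ _ _ loop_span isoM).
- move=> k kn; have [N N0 HN] := Hsigma (Ordinal kn).
  apply: (root_of_power symp_mxQT S1 SM (s := N%:R)).
    by rewrite pnatr_eq0 -lt0n.
  by exists (@sigma n.+1 (Ordinal kn) ^+ N)%g; rewrite ?rho_sigmaX.
- move=> k kn; have := form_loop (Ordinal (ltnW kn)) (Ordinal kn).
  by rewrite /= eqxx gtn_eqF ?subr0 => [->|]; rewrite ?oner_eq0 // ltnW.
- move=> j k jk kn; have jn : (j < n)%N := ltn_trans jk (ltnW kn).
  have := form_loop (Ordinal jn) (Ordinal kn); rewrite /= => ->.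
  by rewrite eqSS ltn_eqF // gtn_eqF ?subrr // (leq_trans jk) // ltnW.
Qed.

End SymplecticImage.

(** * Transience *)

(** The polynomial as a function on rational matrices, where the closure
    arguments take place. *)
Definition poly_evalQ d (P : mpoly.mpoly (d * d) int) (X : 'M[rat]_d) : rat :=
  \sum_(m <- mpoly.msupp P)
    (mpoly.mcoeff m P)%:~R * \prod_i mxvec X 0 i ^+ (mpoly.fun_of_multinom m i).

Lemma poly_evalQ_polyfun d (P : mpoly.mpoly (d * d) int) :
  polyfun (poly_evalQ P).
Proof.
apply: polyfun_sum => m; apply: polyfun_mul; first exact: polyfun_cst.
apply: polyfun_prod => i; apply: polyfun_exp.
case: (mxvec_indexP i) => j k.
by apply: eq_polyfun (polyfun_coord _ j k) => X; rewrite mxvecE.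
Qed.

Lemma poly_evalQE d (P : mpoly.mpoly (d * d) int) (M : 'M[int]_d) :
  poly_evalQ P (map_mx intr M) = (eval_at_mx P M)%:~R.
Proof.
rewrite /eval_at_mx mpoly.mevalE rmorph_sum /=; apply: eq_bigr => m _.
rewrite rmorphM rmorph_prod /=; congr (_ * _); apply: eq_bigr => i _.
by rewrite rmorphXn -map_mxvec mxE.
Qed.

Theorem theorem3 (R : realType) (n : nat) (hn : (2 <= n)%N)
    (mu : braid n.+1 -> R) (hmu : fs_probability mu)
    (hnondeg : nondegenerate_measure mu)
    (h3 : n.+1 = 3%N -> forall i : 'I_n,
      mu (@sigma n.+1 i) != 0 /\ mu ((@sigma n.+1 i)^-1)%g != 0)
    (b : symplectic_basis n)
    (P : mpoly.mpoly ((n./2 + n./2) * (n./2 + n./2)) int)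
    (hP : exists2 M : 'M[int]_(n./2 + n./2), Sp n./2 M & eval_at_mx P M != 0) :
  transient mu
    [set g : braid n.+1 | eval_at_mx P (symplectic_rep b g) = 0].
Proof.
have [mu_ge0 /finite_seqP[s0 s0E] mu_sum] := hmu.
pose s := undup s0.
have s_uniq : uniq s := undup_uniq s0.
have sE : supp mu = [set` s].
  by rewrite s0E; apply/seteqP; split=> x; rewrite /= mem_undup.
have mu_sum1 : \sum_(x <- s) mu x = 1.
  rewrite -mu_sum (bigfs _ s_uniq) => [|x _ xs].
    by apply: eq_fsbigl; apply/seteqP; split.
  by apply/eqP; apply: contraNT xs => mux; have : supp mu x by []; rewrite sE.
have mu_gt0 x : x \in s -> 0 < mu x.
  move=> xs; rewrite lt_neqAle mu_ge0 eq_sym andbT.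
  by have : [set` s] x by []; rewrite -sE.
have reach_all := reach_nondegenerate sE hnondeg.
have [m [rep [u [c [rep1 repM rep_poly repE]]]]] :=
  polyfun_matrix_coefficient (poly_evalQ_polyfun P).
(* Row subspaces call for the transposed representation. *)
pose A g := (rep (rho b g))^T; pose phi g := (rep (rho b g) *m c)^T.
have A1 : A 1%g = 1%:M by rewrite /A rho1 rep1 trmx1.
have AM x y : A (x * y)%g = A y *m A x by rewrite /A rhoM repM trmx_mul.
have phiM x h : phi (x * h)%g = phi h *m A x.
  by rewrite /phi /A rhoM repM -trmx_mul mulmxA.
pose U := kermx u^T.
have insideU g : inside phi U g = (eval_at_mx P (symplectic_rep b g) == 0).
  have evE : (eval_at_mx P (symplectic_rep b g))%:~R
      = (u *m (rep (rho b g) *m c)) 0 0 by rewrite mulmxA -repE poly_evalQE.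
  rewrite -(intr_eq0 rat) evE; apply/sub_kermxP/eqP; rewrite -trmx_mul.
    by move/(congr1 trmx); rewrite trmxK trmx0 => ->; rewrite mxE.
  by move=> u0; rewrite [u *m _]mx11_scalar u0 raddf0 trmx0.
have -> : [set g | eval_at_mx P (symplectic_rep b g) = 0] = [set` inside phi U].
  by apply/seteqP; split=> g /=;
    rewrite -[g \in _]/(inside phi U g) insideU => /eqP.
rewrite /transient; under eq_fun do rewrite (walk_massE _ _ s_uniq sE).
pose E := [seq @sigma n.+1 i | i <- enum 'I_n].
apply: (subspace_mass_to0 mu_ge0 mu_sum1 mu_gt0 reach_all A1 AM phiM (E := E)).
- move=> V g0 Vg0 Vstab g.
  pose H h := (V *m A h <= V)%MS.
  have H1 : H 1%g by rewrite /H A1 mulmx1.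
  have HM x y : H x -> H y -> H (x * y)%g.
    by rewrite /H AM mulmxA => Hx Hy; apply: submx_trans Hx; exact: submxMr.
  have Hsigma (i : 'I_n) : exists2 N, (0 < N)%N & H (@sigma n.+1 i ^+ N)%g.
    by apply: Vstab; apply/mapP; exists i; rewrite ?mem_enum.
  (* The conditions for [phi (h * g0)] to lie in [V], as functions of [rho h]. *)
  pose f j X := (phi g0 *m (rep X)^T *m cokermx V) 0 j.
  have fpoly j : polyfun (f j).
    apply: (@eq_polyfun _ _ (fun X =>
        \sum_k (\sum_l phi g0 0 l * rep X k l) * cokermx V k j)) => [X|].
      rewrite /f mxE; apply: eq_bigr => k _; congr (_ * _).
      by rewrite mxE; apply: eq_bigr => l _; rewrite !mxE.
    apply: polyfun_sum => k; apply: polyfun_mul; last exact: polyfun_cst.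
    by apply: polyfun_sum => l; apply: polyfun_mul => //; exact: polyfun_cst.
  have -> : g = (g * g0^-1 * g0)%g by rewrite -mulgA mulVg mulg1.
  rewrite /inside phiM submxE; apply/eqP/rowP => j; rewrite [RHS]mxE.
  apply: (rho_zariski_dense (b := b) H1 HM Hsigma (rho_isometry b _) (fpoly j)).
  move=> _ [h Hh ->]; rewrite /f /=.
  have : (phi g0 *m A h <= V)%MS by apply: submx_trans Hh; exact: submxMr.
  by rewrite submxE => /eqP /matrixP/(_ 0 j) fh0; rewrite [LHS]fh0 mxE.
- move=> cU; case: hP => M MSp /negP; apply.
  rewrite -(intr_eq0 rat) -poly_evalQE; apply/eqP.
  apply: (rho_zariski_dense (b := b) (H := fun=> True) _ _ _ (Sp_isometry MSp)
    (poly_evalQ_polyfun P)) => //; first by move=> i; exists 1%N.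
  move=> _ [h _ ->]; rewrite poly_evalQE; have := cU h.
  by rewrite insideU => /eqP ->.
Qed.
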